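(* Assume that $f$ is the family of multivariate location-covariance Gaussian densities on $\mathbb{R}^d$, i.e. $f(\cdot|\mu,\Sigma)$ is the density of $N(\mu,\Sigma)$, and that $h_0(x)=f(x|\mu_0,\Sigma_0)$ for some $(\mu_0,\Sigma_0)\in\Theta\times\Omega$. For $G=(\lambda,\mu,\Sigma)$ and $G_*=(\lambda^*,\mu^*,\Sigma^* )$ in $\Xi$ denote $$\mathcal Q(G,G_* )=\lambda(\|\Delta\mu\|^4+\|\Delta\Sigma\|^2)+\lambda^*(\|\Delta\mu^*\|^4+\|\Delta\Sigma^*\|^2)$$ $$-\min\{\lambda,\lambda^*\}\big(\|\Delta\mu\|^4+\|\Delta\Sigma\|^2+\|\Delta\mu^*\|^4+\|\Delta\Sigma^*\|^2\big)$$ $$+\big(\lambda(\|\Delta\mu\|^2+\|\Delta\Sigma\|)+\lambda^*(\|\Delta\mu^*\|^2+\|\Delta\Sigma^*\|)\big)\big(\|\mu-\mu^*\|^2+\|\Sigma-\Sigma^*\|\big).$$ Then there is a positive constant $C$ depending only on $\Theta$, $\Omega$ and $(\mu_0,\Sigma_0)$ such that $V(p_G,p_{G_*})\ge C\,\mathcal Q(G,G_* )$ for all $G,G_*\in\Xi$.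
   Context: $\Theta\subset\mathbb{R}^d$ and $\Omega\subset\mathbb{R}^{d\times d}$ are compact, $\Omega$ consisting of symmetric positive definite matrices. $\Xi=[0,1]\times\Theta\times\Omega$, and for $G=(\lambda,\mu,\Sigma)\in\Xi$, $p_G(x)=(1-\lambda)h_0(x)+\lambda f(x|\mu,\Sigma)$. $V(p,q)=\frac12\int|p-q|\,dx$ is total variation. $\Delta\mu=\mu-\mu_0$, $\Delta\Sigma=\Sigma-\Sigma_0$, $\Delta\mu^*=\mu^*-\mu_0$, $\Delta\Sigma^*=\Sigma^*-\Sigma_0$. Norms are Euclidean (Frobenius for matrices). *)

(* Defs.v *)
From HB Require Import structures.
From mathcomp Require Import all_boot all_order all_algebra.
From mathcomp Require Import all_classical all_reals all_analysis.

Set Implicit Arguments.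
Unset Strict Implicit.
Unset Printing Implicit Defensive.

Import Order.TTheory GRing.Theory Num.Theory.
Import numFieldNormedType.Exports.

Local Open Scope classical_set_scope.
Local Open Scope ring_scope.

Definition tuple_cons (T : Type) (n : nat) (p : T * n.-tuple T) : n.+1.-tuple T :=
  [tuple of p.1 :: p.2].

Section tuple_cons_measurable.
Context d (T : measurableType d) (n : nat).

Lemma measurable_tuple_cons :
  measurable_fun [set: T * n.-tuple T] (@tuple_cons T n).
Proof. exact: measurable_cons. Qed.

End tuple_cons_measurable.

Section pushforward_tuple_cons.
Context d (T : measurableType d) (R : realType) (n : nat).
Variables (m1 : {sigma_finite_measure set T -> \bar R})
          (m2 : {sigma_finite_measure set (n.-tuple T) -> \bar R}).

Definition product_tuple : set (n.+1.-tuple T) -> \bar R :=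
  pushforward (m1 \x m2)%E (@tuple_cons T n).

Let mu : {measure set (n.+1.-tuple T) -> \bar R} :=
  measure_function_pushforward__canonical__measure_function_Measure
    (m1 \x m2)%E (@measurable_tuple_cons d T n).

HB.instance Definition _ := isMeasure.Build _ _ _ product_tuple
  (@measure0 _ _ _ mu) (@measure_ge0 _ _ _ mu)
  (@measure_semi_sigma_additive _ _ _ mu).

Let product_tuple_sigma_finite : sigma_finite setT product_tuple.
Proof.
have /sigma_finiteP[F [FT ndF Foo]] := sigma_finiteT m1.
have /sigma_finiteP[G [GT ndG Goo]] := sigma_finiteT m2.
pose H k := [set t : n.+1.-tuple T |
  F k (thead t) /\ G k [tuple of behead t]].
have hdE (x : T) (t : n.-tuple T) : thead (tuple_cons (x, t)) = x.
  exact: theadE.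
have tlE (x : T) (t : n.-tuple T) : [tuple of behead (tuple_cons (x, t))] = t.
  exact/val_inj.
have consH k : @tuple_cons T n @^-1` H k = F k `*` G k.
  rewrite /preimage /H; apply/seteqP; split=> -[x t];
  by rewrite /mkset hdE tlE.
exists H.
  apply/esym; rewrite -subTset => t _.
  have [k _ Fk] : (\bigcup_k F k) (thead t) by rewrite -FT.
  have [l _ Gl] : (\bigcup_k G k) [tuple of behead t] by rewrite -GT.
  exists (maxn k l) => //; split.
    by move: (thead t) Fk; exact/subsetPset/ndF/leq_maxl.
  by move: [tuple of behead t] Gl; exact/subsetPset/ndG/leq_maxr.
move=> k; have [mF Fk] := Foo k; have [mG Gk] := Goo k; split; last first.
  rewrite /product_tuple /pushforward consH product_measure1E//.
  by rewrite lte_mul_pinfty// ge0_fin_numE.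
apply: measurableI.
  by rewrite -[X in measurable X]setTI; exact: (measurable_tnth ord0).
by rewrite -[X in measurable X]setTI; exact: measurable_behead.
Qed.

HB.instance Definition _ :=
  Measure_isSigmaFinite.Build _ _ _ product_tuple product_tuple_sigma_finite.

End pushforward_tuple_cons.

Section lebesgue_tuple.
Variable R : realType.
Local Notation mR := (measurableTypeR R).

(* The library has no Lebesgue measure on R^n: this is the n-fold product of
   the one-dimensional one, on n-tuples with their product sigma-algebra. *)
Fixpoint lebesgue_tuple (n : nat) : set (n.-tuple mR) -> \bar R :=
  match n with
  | 0 => \d_[tuple]
  | k.+1 => pushforward (lebesgue_measure \x @lebesgue_tuple k)%E
              (@tuple_cons mR k)
  end.
Arguments lebesgue_tuple : clear implicits.

Let lebesgue_tuple_sigma_finite_measure n :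
  exists mu : {sigma_finite_measure set (n.-tuple mR) -> \bar R},
    lebesgue_tuple n = mu.
Proof.
elim: n => [|n [mu IH]] /=.
  by exists (\d_[tuple] : {sigma_finite_measure set _ -> \bar R}).
by rewrite IH; exists (product_tuple lebesgue_measure mu).
Qed.

Let lebesgue_tuple0 n : lebesgue_tuple n set0 = 0%E.
Proof. by have [mu ->] := lebesgue_tuple_sigma_finite_measure n. Qed.

Let lebesgue_tuple_ge0 n A : (0 <= lebesgue_tuple n A)%E.
Proof. by have [mu ->] := lebesgue_tuple_sigma_finite_measure n. Qed.

Let lebesgue_tuple_sigma_additive n : semi_sigma_additive (lebesgue_tuple n).
Proof.
have [mu ->] := lebesgue_tuple_sigma_finite_measure n.
exact: measure_semi_sigma_additive.
Qed.

HB.instance Definition _ n := isMeasure.Build _ _ _ (lebesgue_tuple n)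
  (lebesgue_tuple0 n) (@lebesgue_tuple_ge0 n) (@lebesgue_tuple_sigma_additive n).

Let lebesgue_tuple_sigma_finite n : sigma_finite setT (lebesgue_tuple n).
Proof.
have [mu ->] := lebesgue_tuple_sigma_finite_measure n; exact: sigma_finiteT.
Qed.

HB.instance Definition _ n := Measure_isSigmaFinite.Build _ _ _
  (lebesgue_tuple n) (lebesgue_tuple_sigma_finite n).

Lemma lebesgue_tuple_box n (A : 'I_n -> set mR) :
  (forall i, measurable (A i)) ->
  lebesgue_tuple n [set t | forall i, A i (tnth t i)] =
  (\prod_(i < n) lebesgue_measure (A i))%E.
Proof.
elim: n A => [|n IH] A mA /=.
  by rewrite big_ord0 diracE mem_set//= => -[].
rewrite big_ord_recl -IH; last by move=> i; exact: mA.
rewrite -product_measure1E//; last first.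
  rewrite (_ : [set t | _] = \bigcap_(i in [set: 'I_n])
      ((@tnth n mR)^~ i @^-1` A (lift ord0 i))).
    apply: fin_bigcap_measurable => // i _.
    by rewrite -[X in measurable X]setTI; exact: measurable_tnth.
  by apply/seteqP; split=> t /= At i => [_|]; exact: At.
rewrite /pushforward; congr (_ _).
apply/seteqP; split=> -[x t] /=.
  move=> At; split; first by have := At ord0; rewrite tnth0.
  by move=> i; have := At (lift ord0 i); rewrite tnthS.
by move=> [A0 At] i; case: (unliftP ord0 i) => [j|] ->; rewrite ?tnthS ?tnth0.
Qed.

End lebesgue_tuple.
Arguments lebesgue_tuple R n : clear implicits.

Section gaussian.
Variables (R : realType) (d : nat).
Implicit Types (x mu v : 'rV[R]_d) (S : 'M[R]_d) (p q h : 'rV[R]_d -> R).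

Definition pos_def_mx S : Prop :=
  S^T = S /\ forall v, v != 0 -> 0 < (v *m S *m v^T) 0 0.

(* Vectors are rows, so this is the usual
   (2 pi)^(-d/2) (det S)^(-1/2) exp(- (x - mu)^T S^-1 (x - mu) / 2). *)
Definition gaussian_pdf mu S x : R :=
  (Num.sqrt ((2 * pi) ^+ d * \det S))^-1 *
  expR (- (2^-1 * ((x - mu) *m invmx S *m (x - mu)^T) 0 0)).

Definition rV_of_tuple (t : d.-tuple (measurableTypeR R)) : 'rV[R]_d :=
  \row_i (tnth t i : R).

Definition tv_dist p q : \bar R :=
  ((2^-1)%:E * \int[lebesgue_tuple R d]_t
     `|p (rV_of_tuple t) - q (rV_of_tuple t)|%:E)%E.

(* (lambda, mu, Sigma) *)
Definition mix_param := (R * 'rV[R]_d * 'M[R]_d)%type.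

Definition mix_param_space (Theta : set 'rV[R]_d) (Omega : set 'M[R]_d) : set mix_param :=
  `[0, 1] `*` Theta `*` Omega.

Definition mixture h (f : 'rV[R]_d -> 'M[R]_d -> 'rV[R]_d -> R) (G : mix_param) x : R :=
  let: (lam, mu, Sigma) := G in (1 - lam) * h x + lam * f mu Sigma x.

End gaussian.

(* Frobenius norm; the Euclidean one on row vectors (the library's `|_| on
   matrices is the sup norm). *)
Definition frob (R : realType) (m n : nat) (A : 'M[R]_(m, n)) : R :=
  Num.sqrt (\sum_i \sum_j A i j ^+ 2).

Definition calQ (R : realType) (d : nat) (mu0 : 'rV[R]_d) (Sigma0 : 'M[R]_d)
    (G Gs : mix_param R d) : R :=
  let: (lam, mu, Sigma) := G in
  let: (lams, mus, Sigmas) := Gs in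
  let Dmu := frob (mu - mu0) in
  let DS := frob (Sigma - Sigma0) in
  let Dmus := frob (mus - mu0) in
  let DSs := frob (Sigmas - Sigma0) in
  lam * (Dmu ^+ 4 + DS ^+ 2) + lams * (Dmus ^+ 4 + DSs ^+ 2)
  - Num.min lam lams * (Dmu ^+ 4 + DS ^+ 2 + Dmus ^+ 4 + DSs ^+ 2)
  + (lam * (Dmu ^+ 2 + DS) + lams * (Dmus ^+ 2 + DSs))
    * (frob (mu - mus) ^+ 2 + frob (Sigma - Sigmas)).

(* Main.v *)
(* Testing p_G - p_{G'} against the functions cos(<t, x - mu_0> + phi), which are
   bounded by 1, bounds from above by 2 V(p_G, p_{G'}) the differences of the
   characteristic functions. Here primes stand for the stars of the statement, and
   l for lambda. For fixed t put th = <t, Delta mu>,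
   s = <t, Delta Sigma t>, w = e^(-s/2) sin th and 1 - a = e^(-s/2) cos th. The
   characteristic functions at t and 2t then say that the four quantities
   l * h_i(w, a) - l' * h_i(w', a') are O(V), where h_1 = w, h_2 = a and
   h_3, h_4 are explicit polynomials with leading parts w^3 - 3 a w and w^4 - 6 a^2
   (w has weight 1 and a weight 2). Multiplying crosswise by h_j(w', a') and
   eliminating gives
     l (w^2 + |a|) ((|w| + |w'|) |w - w'| + |a - a'|) = O(V),
   hence also (l - l') (w^2 + |a|)^2 = O(V) when l' <= l.
   In terms of th and s these are the one-dimensional forms of the two parts of Q.
   Finally t can be chosen in a fixed bounded set so that the projections along t see
   both (Delta mu, Delta Sigma) and (mu - mu', Sigma - Sigma') up to a constant. *)

Require Import Defs.
From mathcomp Require Import all_boot all_order all_algebra.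
From mathcomp Require Import all_classical all_reals all_analysis.
From mathcomp Require Import measurable_realfun.
From mathcomp Require Import ring lra.

Set Implicit Arguments.
Unset Strict Implicit.
Unset Printing Implicit Defensive.

Import Order.TTheory GRing.Theory Num.Theory.
Import numFieldNormedType.Exports.

Local Open Scope classical_set_scope.
Local Open Scope ring_scope.

(** * Gaussian integrals *)

Section line.
Variable R : realType.
Local Notation leb := (@lebesgue_measure R).
Implicit Types (a nu m phi : R).

Definition gauss_kernel a nu (y : R) : R := expR (- (2^-1 * a * (y - nu) ^+ 2)).

Lemma gauss_kernelE a nu : 0 < a ->
  gauss_kernel a nu = normal_fun nu (Num.sqrt a)^-1.
Proof.
move=> a0; apply/funext => y; rewrite /gauss_kernel /normal_fun; congr expR.
rewrite exprVn sqr_sqrtr ?(ltW a0)//.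
by field; rewrite gt_eqF.
Qed.

Lemma integral_gauss_kernel a nu : 0 < a ->
  (\int[leb]_y (gauss_kernel a nu y)%:E = (Num.sqrt (2 * pi / a))%:E)%E.
Proof.
move=> a0; rewrite gauss_kernelE//.
have s0 : (Num.sqrt a)^-1 != 0 by rewrite invr_eq0 sqrtr_eq0 -ltNge.
rewrite -[normal_fun _ _]/(fun x => normal_fun _ _ x).
have := integral_normal_pdf nu (Num.sqrt a)^-1.
have := @integrable_normal_pdf R nu (Num.sqrt a)^-1.
rewrite normal_pdfE// => ip.
have p0 := normal_peak_gt0 s0.
have pn0 := lt0r_neq0 p0.
have ig : leb.-integrable setT (EFin \o normal_fun nu (Num.sqrt a)^-1).
  rewrite (_ : _ \o _ = (fun x => (normal_peak (Num.sqrt a)^-1)^-1%:E *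
    (normal_peak (Num.sqrt a)^-1 * normal_fun nu (Num.sqrt a)^-1 x)%:E)%E).
    exact: integrableZl.
  by apply/funext => x /=; rewrite -EFinM mulKf.
under eq_integral do rewrite EFinM.
rewrite integralZl//= => /(congr1 (fun z => ((normal_peak (Num.sqrt a)^-1)^-1%:E * z)%E)).
rewrite muleA -EFinM mulVf// mul1e mule1 => ->.
rewrite /normal_peak invrK; congr (Num.sqrt _)%:E.
rewrite exprVn sqr_sqrtr ?(ltW a0)//.
by field; rewrite gt_eqF.
Qed.

Lemma measurable_gauss_kernel a nu : measurable_fun setT (gauss_kernel a nu).
Proof.
apply: measurableT_comp => //; apply: measurableT_comp => //.
apply: measurable_funM => //; apply: measurable_funX.
exact: measurable_funB.
Qed.

Lemma integrable_gauss_kernel a nu : 0 < a ->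
  leb.-integrable setT (EFin \o gauss_kernel a nu).
Proof.
move=> a0; apply/integrableP; split.
  by apply/measurable_EFinP; exact: measurable_gauss_kernel.
under eq_integral do rewrite /= ger0_norm ?expR_ge0//.
by rewrite integral_gauss_kernel// ltry.
Qed.

(** Half of the exponent is kept; the other half absorbs [|y - nu|] through [1 + x <= expR x] and a
    completed square. This is the integrable majorant for kernels carrying a factor [y - nu]. *)
Lemma abs_le_gauss_kernel a nu y : 0 < a ->
  `|y - nu| * gauss_kernel a nu y <= (1 + a^-1) * gauss_kernel (a / 2) nu y.
Proof.
move=> a0; rewrite /gauss_kernel.
set z := y - nu.
have -> : expR (- (2^-1 * a * z ^+ 2)) =
    expR (- (2^-1 * (a / 2) * z ^+ 2)) * expR (- (4^-1 * a * z ^+ 2)).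
  by rewrite -expRD; congr expR; field.
rewrite mulrCA mulrC ler_wpM2r ?expR_ge0//.
have e1 := expR_ge1Dx (4^-1 * a * z ^+ 2).
have e0 := expR_gt0 (4^-1 * a * z ^+ 2).
rewrite expRN ler_pdivrMr//.
have ai : 0 < a^-1 by rewrite invr_gt0.
have aa : a * a^-1 = 1 by rewrite mulfV// gt_eqF.
have zz : z ^+ 2 = `|z| ^+ 2 by rewrite real_normK// num_real.
have z0 : 0 <= `|z| by [].
apply: (@le_trans _ _ ((1 + a^-1) * (1 + 4^-1 * a * z ^+ 2))); last first.
  by rewrite ler_wpM2l// addr_ge0// ltW.
rewrite zz; set t := `|z| in z0 *.
rewrite -subr_ge0.
have -> : (1 + a^-1) * (1 + 4^-1 * a * t ^+ 2) - t =
  (t / 2 - 1) ^+ 2 + a^-1 + 4^-1 * a * t ^+ 2 + 4^-1 * (a * a^-1 - 1) * t ^+ 2.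
  by field; rewrite gt_eqF.
rewrite aa subrr mulr0 mul0r addr0 !addr_ge0 ?sqr_ge0 ?(ltW ai)//.
by rewrite !mulr_ge0 ?sqr_ge0// ltW.
Qed.

(** The fundamental theorem on growing intervals leaves boundary values that vanish in the limit,
    and [|h'|] dominates the truncated integrands. *)
Lemma integral_derive_eq0 (h h' : R -> R) :
  (forall x : R, is_derive x 1 h (h' x)) -> continuous h' ->
  leb.-integrable setT (EFin \o h') ->
  h n%:R @[n --> \oo] --> (0 : R) -> h (- n%:R) @[n --> \oo] --> (0 : R) ->
  (\int[leb]_y (h' y)%:E = 0)%E.
Proof.
move=> dh ch ih hy hNy.
(* Radius [n.+1] keeps every interval nondegenerate, as the fundamental theorem requires. *)
pose I n := [set` `[(- n.+1%:R : R), n.+1%:R]].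
have mI n : measurable (I n) by exact: measurable_itv.
have H n : (\int[leb]_(y in I n) (h' y)%:E = (h n.+1%:R - h (- n.+1%:R))%:E)%E.
  rewrite (@continuous_FTC2 _ h' h) -?EFinB//.
  - by rewrite gtrN.
  - exact: continuous_subspaceT.
  - have hc x : h y @[y --> x] --> h x.
      by apply: differentiable_continuous; apply/derivable1_diffP; case: (dh x).
    split.
    + by move=> x _; case: (dh x).
    + exact: cvg_at_right_filter.
    + exact: cvg_at_left_filter.
  - by move=> x _; rewrite derive1E; case: (dh x).
have mh : measurable_fun setT h' by exact: continuous_measurable_fun.
have C1 : (\int[leb]_y ((h' \_ (I n)) y)%:E @[n --> \oo] --> \int[leb]_y (h' y)%:E)%E.
  apply: (@dominated_cvg _ _ _ leb setT measurableT
    (fun n y => ((h' \_ (I n)) y)%:E) _ (fun y => `|(h' y)%:E|%E)) => //.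
  - move=> n; apply/measurable_EFinP; apply/(measurable_restrictT h' (mI n)).
    exact: measurable_funTS.
  - move=> x _; apply: cvg_near_cst.
    exists (Num.truncn `|x|).+1 => // n /= xn.
    rewrite patchE mem_set//= /I/= in_itv/= -ler_norml.
    apply: (@le_trans _ _ (Num.truncn `|x|).+1%:R); first exact/ltW/truncnS_gt.
    by rewrite ler_nat ltnW.
  - exact: integrable_abse.
  - move=> n x _; rewrite patchE; case: ifP => // _.
    by change ((`|(0 : R)|%:E <= `|h' x|%:E)%E); rewrite normr0 lee_fin.
have C2 : (\int[leb]_y ((h' \_ (I n)) y)%:E @[n --> \oo] --> 0%:E)%E.
  have -> : (fun n => \int[leb]_y ((h' \_ (I n)) y)%:E)%E =
      (fun n => (h n.+1%:R - h (- n.+1%:R))%:E).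
    apply/funext => n; rewrite -H [in RHS]integral_mkcond.
    by apply: eq_integral => y _; rewrite !patchE; case: ifP.
  apply: cvg_EFin; first by apply: nearW.
  rewrite -[X in _ --> X](subrr 0); apply: cvgB.
    by rewrite (cvg_shiftS (fun n => h n%:R)).
  by rewrite (cvg_shiftS (fun n => h (- n%:R))).
exact: cvg_unique C1 C2.
Qed.

Lemma gauss_kernel_cvg a nu (u : nat -> R) : 0 < a ->
  (forall n, n%:R <= `|u n|) -> gauss_kernel a nu (u n) @[n --> \oo] --> (0 : R).
Proof.
move=> a0 un.
(* Chosen so that [n.+1] times the kernel is at most [K]: the part [|u n - nu|] of [n.+1] costs
   [1 + a^-1] by [abs_le_gauss_kernel], the rest [|nu| + 1]. *)
pose K := 1 + a^-1 + `|nu| + 1.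
apply: (@squeeze_cvgr _ _ _ _ (fun=> 0) (fun n => K * harmonic n)).
- apply: nearW => n; rewrite expR_ge0 /= ler_pdivlMr ?ltr0Sn//.
  have g1 b y : 0 <= b -> gauss_kernel b nu y <= 1.
    by move=> b0; rewrite -expR0 ler_expR lerNl oppr0 mulr_ge0 ?sqr_ge0// mulr_ge0.
  have g0 : 0 <= gauss_kernel a nu (u n) by exact: expR_ge0.
  have gn : gauss_kernel a nu (u n) <= 1 by rewrite g1// ltW.
  have H1 := abs_le_gauss_kernel nu (u n) a0.
  have H2 : gauss_kernel (a / 2) nu (u n) <= 1 by rewrite g1// ltW// divr_gt0.
  have ai : 0 < a^-1 by rewrite invr_gt0.
  have H3 : n%:R <= `|u n - nu| + `|nu|.
    by rewrite (le_trans (un n))// -{1}(subrK nu (u n)) ler_normD.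
  rewrite -natr1 /K.
  have n0 := normr_ge0 nu.
  by nra.
- exact: cvg_cst.
- by rewrite -[X in _ --> X](mulr0 K); apply: cvgMr; exact: cvg_harmonic.
Qed.

Lemma integrable_gauss_kernelM a nu (f : R -> R) : 0 < a ->
  measurable_fun setT f -> (forall y, `|f y| <= 1) ->
  leb.-integrable setT (fun y => (gauss_kernel a nu y * f y)%:E).
Proof.
move=> a0 mf f1.
apply: le_integrable (integrable_gauss_kernel nu a0) => //.
  by apply/measurable_EFinP; apply: measurable_funM => //; exact: measurable_gauss_kernel.
move=> y _; rewrite lee_fin /= normrM [leRHS]ger0_norm ?expR_ge0//.
by rewrite ger0_norm ?expR_ge0// ler_piMr ?expR_ge0.
Qed.

Lemma integrable_gauss_kernelXM a nu (f : R -> R) : 0 < a ->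
  measurable_fun setT f -> (forall y, `|f y| <= 1) ->
  leb.-integrable setT (fun y => (gauss_kernel a nu y * ((y - nu) * f y))%:E).
Proof.
move=> a0 mf f1.
have a20 : 0 < a / 2 by rewrite divr_gt0.
have ig := integrable_gauss_kernel nu a20.
apply: le_integrable (integrableZl _ (1 + a^-1) ig) => //.
  apply/measurable_EFinP; apply: measurable_funM; first exact: measurable_gauss_kernel.
  by apply: measurable_funM => //; exact: measurable_funB.
move=> y _; rewrite lee_fin /= normrM ger0_norm ?expR_ge0// normrM.
rewrite [leRHS]ger0_norm; last first.
  by rewrite mulr_ge0 ?expR_ge0// addr_ge0// invr_ge0 ltW.
apply: le_trans (abs_le_gauss_kernel nu y a0).
by rewrite mulrC ler_wpM2r ?expR_ge0// ler_piMr.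
Qed.

Lemma measurable_cos : measurable_fun setT (@cos R).
Proof. by apply: continuous_measurable_fun; exact: continuous_cos. Qed.

Lemma measurable_cos_affine m nu phi :
  measurable_fun setT (fun y : R => cos (m * (y - nu) + phi)).
Proof.
apply: continuous_measurable_fun => y.
apply: differentiable_continuous; apply/derivable1_diffP.
by [].
Qed.

Lemma is_derive_gauss_kernel_sin a nu m phi (x : R) :
  is_derive x 1 (fun y => gauss_kernel a nu y * sin (m * (y - nu) + phi))
   (m * (gauss_kernel a nu x * cos (m * (x - nu) + phi)) -
    a * (gauss_kernel a nu x * ((x - nu) * sin (m * (x - nu) + phi)))).
Proof.
rewrite /gauss_kernel.
apply: is_derive_eq.
by rewrite /GRing.scale /=; field.
Qed.

Lemma measurable_sin_affine m nu phi :
  measurable_fun setT (fun y : R => sin (m * (y - nu) + phi)).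
Proof.
apply: continuous_measurable_fun => y.
by apply: differentiable_continuous; apply/derivable1_diffP.
Qed.

(** Integration by parts: kernel times sine vanishes at both ends, so its derivative integrates to
    zero. *)
Lemma integral_gauss_kernel_sin a nu m phi : 0 < a ->
  \int[leb]_y (gauss_kernel a nu y * ((y - nu) * sin (m * (y - nu) + phi))) =
   m / a * \int[leb]_y (gauss_kernel a nu y * cos (m * (y - nu) + phi)).
Proof.
move=> a0.
have ic := integrable_gauss_kernelM nu a0 (measurable_cos_affine m nu phi)
  (fun y => cos_max _).
have is_ := integrable_gauss_kernelXM nu a0 (measurable_sin_affine m nu phi)
  (fun y => sin_max _).
have icm : leb.-integrable setT (fun y =>
    (m * (gauss_kernel a nu y * cos (m * (y - nu) + phi)))%:E).
  by under eq_fun do rewrite EFinM; exact: integrableZl.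
have ism : leb.-integrable setT (fun y =>
    (a * (gauss_kernel a nu y * ((y - nu) * sin (m * (y - nu) + phi))))%:E).
  by under eq_fun do rewrite EFinM; exact: integrableZl.
have lim0 (u : nat -> R) : (forall n, n%:R <= `|u n|) ->
    gauss_kernel a nu (u n) * sin (m * (u n - nu) + phi) @[n --> \oo] --> (0 : R).
  move=> un; have gu := gauss_kernel_cvg nu a0 un.
  have gNu : - gauss_kernel a nu (u n) @[n --> \oo] --> (0 : R).
    by rewrite -oppr0; exact: cvgN.
  apply: (squeeze_cvgr _ gNu gu); apply: nearW => n.
  rewrite -ler_norml normrM ger0_norm ?expR_ge0//.
  by rewrite ler_piMr ?expR_ge0// sin_max.
have := @integral_derive_eq0 _ _ (is_derive_gauss_kernel_sin a nu m phi).
move=> /(_ _ _ (lim0 (fun n => n%:R) _) (lim0 (fun n => - n%:R) _)) I0.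
have : \int[leb]_y (m * (gauss_kernel a nu y * cos (m * (y - nu) + phi)) -
    a * (gauss_kernel a nu y * ((y - nu) * sin (m * (y - nu) + phi)))) = 0.
  rewrite /Rintegral I0//.
  - move=> x; apply: differentiable_continuous; apply/derivable1_diffP.
    by rewrite /gauss_kernel.
  - exact: integrableB icm ism.
  - by move=> n; rewrite ger0_norm.
  - by move=> n; rewrite normrN ger0_norm.
rewrite RintegralB// !RintegralZl// => /eqP; rewrite subr_eq0 => /eqP E.
by rewrite mulrAC E mulrAC mulfV ?mul1r// gt_eqF.
Qed.

(* As a function of [m] the integral solves [F' = - (m / a) F]. *)
Lemma Rintegral_gauss_kernel_cos a nu m phi : 0 < a ->
  \int[leb]_y (gauss_kernel a nu y * cos (m * (y - nu) + phi)) =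
  Num.sqrt (2 * pi / a) * expR (- (m ^+ 2 / (2 * a))) * cos phi.
Proof.
move=> a0.
pose f (m y : R) := gauss_kernel a nu y * cos (m * (y - nu) + phi).
pose F m := \int[leb]_y f m y.
have ic k := integrable_gauss_kernelM nu a0 (measurable_cos_affine k nu phi)
  (fun y => cos_max _).
have is_ k := integrable_gauss_kernelXM nu a0 (measurable_sin_affine k nu phi)
  (fun y => sin_max _).
have df (y k : R) : is_derive k 1 (f ^~ y)
    (- (gauss_kernel a nu y * ((y - nu) * sin (k * (y - nu) + phi)))).
  rewrite /f; apply: is_derive_eq; rewrite /GRing.scale /=; ring.
have d1f k y : partial1of2 f k y =
    - (gauss_kernel a nu y * ((y - nu) * sin (k * (y - nu) + phi))).
  by rewrite partial1of2E; case: (df y k).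
have dF (k : R) : is_derive k 1 F (- (k / a * F k)).
  have cF : h^-1 *: (F (h + k) - F k) @[h --> 0^'] --> - (k / a * F k).
    have -> : - (k / a * F k) = \int[leb]_y partial1of2 f k y.
      rewrite -integral_gauss_kernel_sin// -mulN1r -RintegralZl//; last exact: is_.
      by apply: eq_Rintegral => y _; rewrite d1f mulN1r.
    (* Since the sine is bounded by one, the majorant is independent of the frequency; the window
       [(k - 1, k + 1)] is an arbitrary neighbourhood. *)
    apply: (@cvg_differentiation_under_integral R _ _ leb f setT measurableT k
      (k - 1) (k + 1) _ _ _ (fun y => (1 + a^-1) * gauss_kernel (a / 2) nu y)).
    - by rewrite /= in_itv/= ltrBlDr ltrDl ltr01.
    - by move=> x _; exact: ic.
    - by move=> x y _ _; case: (df y x).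
    - by move=> y; rewrite mulr_ge0 ?expR_ge0// addr_ge0// invr_ge0 ltW.
    - have a20 : 0 < a / 2 by rewrite divr_gt0.
      exact: integrableZl (integrable_gauss_kernel nu a20).
    - move=> x y _ _; rewrite d1f normrN.
      apply: le_trans (abs_le_gauss_kernel nu y a0).
      rewrite normrM ger0_norm ?expR_ge0// mulrC ler_wpM2r ?expR_ge0//.
      by rewrite normrM ler_piMr// sin_max.
  apply: DeriveDef.
    apply/cvg_ex; exists (- (k / a * F k)).
    by under eq_fun do rewrite scaler1.
  apply/cvg_lim => //.
  by under eq_fun do rewrite scaler1.
(* With the integrating factor the derivative is zero, so the value at frequency [0], a plain
   Gaussian integral, determines [F]. *)
have FE : F m * expR (m ^+ 2 / (2 * a)) = F 0 * expR (0 ^+ 2 / (2 * a)).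
  apply: (is_derive_0_is_cst (f := fun k => F k * expR (k ^+ 2 / (2 * a)))) => k.
  apply: is_derive_eq; rewrite /GRing.scale /=.
  by field; rewrite gt_eqF.
rewrite -[LHS]/(F m) expRN; apply: (mulIf (lt0r_neq0 (expR_gt0 (m ^+ 2 / (2 * a))))).
rewrite FE expr0n/= mul0r expR0 mulr1.
transitivity (Num.sqrt (2 * pi / a) * cos phi); last first.
  by have := expR_gt0 (m ^+ 2 / (2 * a)); set e := expR _ => e0; field; rewrite gt_eqF.
rewrite /F /f; under eq_Rintegral do rewrite mul0r add0r mulrC.
rewrite RintegralZl//; last exact: integrable_gauss_kernel.
by rewrite /Rintegral integral_gauss_kernel// mulrC.
Qed.

Lemma integral_gauss_kernel_cos a nu m phi : 0 < a ->
  (\int[leb]_y (gauss_kernel a nu y * cos (m * (y - nu) + phi))%:E =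
  (Num.sqrt (2 * pi / a) * expR (- (m ^+ 2 / (2 * a))) * cos phi)%:E)%E.
Proof.
move=> a0; rewrite -(Rintegral_gauss_kernel_cos nu)// /Rintegral fineK//.
apply: integrable_fin_num => //; apply: integrable_gauss_kernelM => //.
  exact: measurable_cos_affine.
by move=> y; exact: cos_max.
Qed.

End line.

(** * Schur complements and positive definiteness *)

Section schur.
Variable R : realType.

Definition bform (d : nat) (A : 'M[R]_d) (u v : 'rV[R]_d) : R :=
  (u *m A *m v^T) 0 0.

(** For a precision matrix [A], this is the precision of the other coordinates once the first is
    integrated out. *)
Definition schur (d : nat) (A : 'M[R]_(1 + d)) : 'M[R]_d :=
  drsubmx A - (A 0 0)^-1 *: (dlsubmx A *m ursubmx A).

Lemma ulsubmx00 (d : nat) (A : 'M[R]_(1 + d)) : ulsubmx A = (A 0 0)%:M.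
Proof.
by rewrite [LHS]mx11_scalar; congr (_%:M); rewrite !mxE; congr (A _ _); apply/val_inj.
Qed.

(** Completes the square in the first coordinate. The polarized form with two vectors splits the
    phase of the cosine in the same way as the Gaussian exponent. *)
Lemma bform_schur (d : nat) (A : 'M[R]_(1 + d)) (u v : 'rV[R]_(1 + d)) :
  A^T = A -> A 0 0 != 0 ->
  bform A u v = (A 0 0)^-1 * (u *m A) 0 0 * (v *m A) 0 0 +
    bform (schur A) (rsubmx u) (rsubmx v).
Proof.
move=> AT a0.
have ETl : dlsubmx A = (ursubmx A)^T by rewrite trmx_ursub AT.
have col0 (w : 'rV[R]_(1 + d)) : (w *m A) 0 0 =
    A 0 0 * (lsubmx w) 0 0 + (rsubmx w *m dlsubmx A) 0 0.
  rewrite -{1}(hsubmxK w) -{1}(submxK A) mul_row_block.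
  rewrite (_ : (0 : 'I_(1 + d)) = lshift d 0); last exact/val_inj.
  rewrite row_mxEl mxE ulsubmx00 mul_mx_scalar mxE.
  by rewrite (_ : (0 : 'I_(1 + d)) = lshift d 0) //; exact/val_inj.
rewrite !col0 /bform /schur.
rewrite -{1}(hsubmxK u) -{1}(hsubmxK v) -{1}(submxK A) mul_row_block.
rewrite tr_row_mx mul_row_col ulsubmx00 mul_mx_scalar.
set u0 := lsubmx u; set u' := rsubmx u; set v0 := lsubmx v; set v' := rsubmx v.
set b := ursubmx A; set c := drsubmx A; set a := A 0 0.
rewrite ETl -/b mulmxBr mulmxBl -scalemxAr -scalemxAl !mulmxDl -scalemxAl.
rewrite [u0]mx11_scalar [v0]mx11_scalar !mul_scalar_mx -scalemxAl.
rewrite -!mulmxA.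
have vb : v' *m b^T = (b *m v'^T)^T by rewrite trmx_mul trmxK.
have ub : u' *m (b^T *m (b *m v'^T)) = (u' *m b^T) *m (b *m v'^T) by rewrite mulmxA.
rewrite ub vb [u' *m b^T]mx11_scalar [b *m v'^T]mx11_scalar.
rewrite [u' *m (_ *m _)]mulmxA [u' *m b^T]mx11_scalar.
rewrite tr_scalar_mx !mul_scalar_mx.
rewrite !mxE /=.
by rewrite !mulr1n; field.
Qed.

Lemma det_schur (d : nat) (A : 'M[R]_(1 + d)) : A 0 0 != 0 ->
  \det A = A 0 0 * \det (schur A).
Proof.
move=> a0.
(* One step of Gaussian elimination: [L] is unipotent and clears the first column below the
   pivot. *)
pose L : 'M[R]_(1 + d) := block_mx 1%:M 0 (- (A 0 0)^-1 *: dlsubmx A) 1%:M.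
have detL : \det L = 1 by rewrite det_lblock !det1 mulr1.
have : L *m A = block_mx (A 0 0)%:M (ursubmx A) 0 (schur A).
  rewrite -{1}(submxK A) mulmx_block !mul1mx !mul0mx !addr0 ulsubmx00; congr block_mx.
    by rewrite mul_mx_scalar scalerA mulrN mulfV// scaleN1r addNr.
  by rewrite /schur addrC scaleNr mulNmx scalemxAl.
move/(congr1 determinant); rewrite det_mulmx detL mul1r => ->.
by rewrite det_ublock det_scalar1.
Qed.

Lemma pos_def_00 (d : nat) (A : 'M[R]_(1 + d)) : pos_def_mx A -> 0 < A 0 0.
Proof.
move=> [_ /(_ (delta_mx 0 0))].
rewrite -rowE trmx_delta -colE !mxE; apply.
apply/eqP => /rowP/(_ 0) /eqP; rewrite !mxE !eqxx /=.
by rewrite oner_eq0.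
Qed.

Lemma pos_def_schur (d : nat) (A : 'M[R]_(1 + d)) :
  pos_def_mx A -> pos_def_mx (schur A).
Proof.
move=> pA; have [AT Apos] := pA; have a0 := pos_def_00 pA.
split.
  rewrite /schur linearB/= linearZ/= trmx_mul.
  have -> : (dlsubmx A)^T = ursubmx A by rewrite trmx_dlsub AT.
  have -> : (ursubmx A)^T = dlsubmx A by rewrite trmx_ursub AT.
  by rewrite trmx_drsub AT.
move=> v v0.
(* The first coordinate is chosen to make [(w *m A) 0 0] vanish, so that the form of [A] at [w] is
   the form of its Schur complement at [v]. *)
pose w : 'rV[R]_(1 + d) := row_mx (- (A 0 0)^-1 *: (v *m dlsubmx A)) v.
have w0 : w != 0.
  by apply: contra_neq v0 => /(congr1 rsubmx); rewrite /w row_mxKr linear0.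
have := Apos w w0; rewrite -[X in 0 < X]/(bform A w w) bform_schur ?gt_eqF//.
rewrite {3 4}/w row_mxKr.
suff -> : (w *m A) 0 0 = 0 by rewrite mulr0 add0r.
rewrite /w -{3}(submxK A) mul_row_block.
rewrite (_ : (0 : 'I_(1 + d)) = lshift d 0); last exact/val_inj.
rewrite row_mxEl ulsubmx00 mul_mx_scalar scalerA -(_ : (0 : 'I_(1 + d)) = lshift d 0); last exact/val_inj.
by rewrite mulrN mulfV ?gt_eqF// scaleN1r addNr mxE.
Qed.

Lemma pos_def_det_gt0 (d : nat) (A : 'M[R]_d) : pos_def_mx A -> 0 < \det A.
Proof.
elim: d A => [|d IH] A pA; first by rewrite det_mx00.
have a0 := pos_def_00 pA.
by rewrite (@det_schur d) ?gt_eqF// mulr_gt0// IH//; exact: pos_def_schur.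
Qed.

End schur.

(** * The Fourier transform of a Gaussian on tuples *)

Section tuple_gauss.
Variable R : realType.
Local Notation mR := (measurableTypeR R).
Local Notation leb := (@lebesgue_measure R).

Lemma measurable_bform d' (T : measurableType d') (d : nat) (A : 'M[R]_d)
    (f g : T -> 'rV[R]_d) :
  (forall i, measurable_fun setT (fun t => f t 0 i)) ->
  (forall i, measurable_fun setT (fun t => g t 0 i)) ->
  measurable_fun setT (fun t => bform A (f t) (g t)).
Proof.
move=> mf mg; rewrite /bform.
under eq_fun do rewrite mxE.
apply: measurable_sum => j; apply: measurable_funM.
  under eq_fun do rewrite mxE.
  by apply: measurable_sum => k; exact: measurable_funM.
rewrite (_ : (fun t => (g t)^T j 0) = (fun t => g t 0 j))//.
by apply/funext => t; rewrite mxE.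
Qed.

Lemma measurable_rV_of_tuple (d : nat) (nu : 'rV[R]_d) i :
  measurable_fun setT (fun t : d.-tuple mR => (rV_of_tuple t - nu) 0 i).
Proof.
under eq_fun do rewrite !mxE.
by apply: measurable_funB => //; exact: measurable_tnth.
Qed.

(** Unnormalized density; [A] is the precision matrix, the inverse of the covariance. *)
Definition gauss_form (d : nat) (A : 'M[R]_d) (nu : 'rV[R]_d) (t : d.-tuple mR) : R :=
  expR (- (2^-1 * bform A (rV_of_tuple t - nu) (rV_of_tuple t - nu))).

Lemma measurable_gauss_form (d : nat) (A : 'M[R]_d) (nu : 'rV[R]_d) :
  measurable_fun setT (gauss_form A nu).
Proof.
apply: measurableT_comp => //; apply: measurableT_comp => //.
apply: measurable_funM => //; apply: measurable_bform => i; exact: measurable_rV_of_tuple.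
Qed.

Lemma rV_of_tuple_cons_sub (d : nat) (nu : 'rV[R]_(1 + d)) (x : mR) (t : d.-tuple mR) :
  rV_of_tuple (tuple_cons (x, t)) - nu =
  row_mx ((x - nu 0 0)%:M : 'rV[R]_1) (rV_of_tuple t - rsubmx nu) :> 'rV[R]_(1 + d).
Proof.
apply/rowP => i; rewrite [LHS]mxE [X in X + _]mxE [X in _ + X]mxE.
case: (split_ordP i) => j ->.
  rewrite row_mxEl !mxE ord1 /= mulr1n.
  by rewrite (_ : lshift d 0 = ord0) ?tnth0//; exact/val_inj.
rewrite row_mxEr !mxE (_ : rshift 1 j = lift ord0 j); last exact/val_inj.
by rewrite tnthS.
Qed.

(* With the other coordinates fixed, the first one is Gaussian with precision
   [A 0 0] and with this mean. *)
Definition cond_mean (d : nat) (A : 'M[R]_(1 + d)) (nu : 'rV[R]_(1 + d)) (t : d.-tuple mR) : R :=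
  nu 0 0 - (A 0 0)^-1 * ((rV_of_tuple t - rsubmx nu) *m dlsubmx A) 0 0.

Lemma mul_tuple_cons (d : nat) (A : 'M[R]_(1 + d)) (nu : 'rV[R]_(1 + d)) x (t : d.-tuple mR) :
  A 0 0 != 0 ->
  (((rV_of_tuple (tuple_cons (x, t)) - nu : 'rV[R]_(1 + d)) *m A) 0 0 =
   A 0 0 * (x - cond_mean A nu t)).
Proof.
move=> a0; rewrite rV_of_tuple_cons_sub /cond_mean.
rewrite -{1}(submxK A) mul_row_block.
have E : (0 : 'I_(1 + d)) = lshift d 0 by exact/val_inj.
have row0 (B : 'M[R]_(1, 1)) (C : 'M[R]_(1, d)) : (row_mx B C) 0 0 = B 0 0.
  by have := row_mxEl B C 0 0; rewrite -E.
rewrite row0 mxE.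
rewrite ulsubmx00 mul_mx_scalar [X in X + _]mxE [X in _ * X + _]mxE mulr1n.
by field.
Qed.

Lemma rsubmx_tuple_cons (d : nat) (nu : 'rV[R]_(1 + d)) x (t : d.-tuple mR) :
  rsubmx (rV_of_tuple (tuple_cons (x, t)) - nu : 'rV[R]_(1 + d)) =
  rV_of_tuple t - rsubmx nu.
Proof. by rewrite rV_of_tuple_cons_sub row_mxKr. Qed.

Lemma gauss_form_cons (d : nat) (A : 'M[R]_(1 + d)) (nu : 'rV[R]_(1 + d)) x (t : d.-tuple mR) :
  A^T = A -> A 0 0 != 0 ->
  gauss_form (d := d.+1) A nu (tuple_cons (x, t)) =
  gauss_kernel (A 0 0) (cond_mean A nu t) x * gauss_form (schur A) (rsubmx nu) t.
Proof.
move=> AT a0; rewrite /gauss_form /gauss_kernel (@bform_schur _ d)// -expRD.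
rewrite mul_tuple_cons// rsubmx_tuple_cons; congr expR.
by field.
Qed.

Lemma bform_cons (d : nat) (A : 'M[R]_(1 + d)) (nu r : 'rV[R]_(1 + d)) x (t : d.-tuple mR) :
  A^T = A -> A 0 0 != 0 ->
  bform (d := d.+1) A r (rV_of_tuple (tuple_cons (x, t)) - nu) =
  (r *m A) 0 0 * (x - cond_mean A nu t) +
  bform (schur A) (rsubmx r) (rV_of_tuple t - rsubmx nu).
Proof.
move=> AT a0; rewrite (@bform_schur _ d)// mul_tuple_cons// rsubmx_tuple_cons.
by congr (_ + _); field.
Qed.

Lemma measurable_gauss_form_cos (d : nat) (A : 'M[R]_d) (nu r : 'rV[R]_d) phi :
  measurable_fun setT (fun t : d.-tuple mR =>
    gauss_form A nu t * cos (bform A r (rV_of_tuple t - nu) + phi)).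
Proof.
apply: measurable_funM; first exact: measurable_gauss_form.
apply: (measurableT_comp (@measurable_cos R)); apply: measurable_funD => //.
apply: measurable_bform => i //; exact: measurable_rV_of_tuple.
Qed.

(** The phase is affine in the first coordinate and centred at the conditional mean; the phase of
    the other coordinates joins [phi]. This is why an arbitrary [phi] is carried along. *)
Lemma integral_gauss_form_cons (d : nat) (A : 'M[R]_(1 + d)) (nu r : 'rV[R]_(1 + d))
    phi (t : d.-tuple mR) : pos_def_mx A ->
  (\int[leb]_x (gauss_form (d := d.+1) A nu (tuple_cons (x, t)) *
     cos (bform (d := d.+1) A r (rV_of_tuple (tuple_cons (x, t)) - nu) + phi))%:E =
  (Num.sqrt (2 * pi / A 0 0) * expR (- ((r *m A) 0 0 ^+ 2 / (2 * A 0 0))))%:E *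
  (gauss_form (schur A) (rsubmx nu) t *
     cos (bform (schur A) (rsubmx r) (rV_of_tuple t - rsubmx nu) + phi))%:E)%E.
Proof.
move=> pA; have [AT _] := pA; have a0 := pos_def_00 pA.
under eq_integral => x _.
  rewrite gauss_form_cons ?gt_eqF// bform_cons ?gt_eqF// -addrA.
  rewrite [_ * gauss_form _ _ _]mulrC -mulrA EFinM.
  over.
rewrite integralZl//; last first.
  apply: integrable_gauss_kernelM => //; first exact: measurable_cos_affine.
  by move=> y; exact: cos_max.
rewrite integral_gauss_kernel_cos// -!EFinM; congr EFin.
by ring.
Qed.

Lemma integral_gauss_form_cons0 (d : nat) (A : 'M[R]_(1 + d)) (nu : 'rV[R]_(1 + d))
    (t : d.-tuple mR) : pos_def_mx A ->
  (\int[leb]_x (gauss_form (d := d.+1) A nu (tuple_cons (x, t)))%:E =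
  (Num.sqrt (2 * pi / A 0 0))%:E * (gauss_form (schur A) (rsubmx nu) t)%:E)%E.
Proof.
move=> pA; have [AT _] := pA; have a0 := pos_def_00 pA.
under eq_integral do rewrite gauss_form_cons ?gt_eqF// mulrC EFinM.
rewrite integralZl//; last exact: integrable_gauss_kernel.
by rewrite integral_gauss_kernel// muleC.
Qed.

(* The real form of the Gaussian Fourier transform, by integrating out the first
   coordinate: a Gaussian times a cosine of an affine phase keeps this shape, with
   [A] replaced by its Schur complement. *)
Theorem gauss_tuple (d : nat) (A : 'M[R]_d) (nu : 'rV[R]_d) : pos_def_mx A ->
  (lebesgue_tuple R d).-integrable setT (EFin \o gauss_form A nu) /\
  forall r phi, (\int[lebesgue_tuple R d]_t
    (gauss_form A nu t * cos (bform A r (rV_of_tuple t - nu) + phi))%:E =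
    (Num.sqrt ((2 * pi) ^+ d / \det A) * expR (- (2^-1 * bform A r r)) * cos phi)%:E)%E.
Proof.
elim: d A nu => [|d IH] A nu pA.
  have b0 u v : bform A u v = 0 by rewrite /bform mxE big_ord0.
  have I0 r phi : (\int[lebesgue_tuple R 0]_t
    (gauss_form A nu t * cos (bform A r (rV_of_tuple t - nu) + phi))%:E =
    (Num.sqrt ((2 * pi) ^+ 0 / \det A) * expR (- (2^-1 * bform A r r)) * cos phi)%:E)%E.
    under eq_integral do rewrite /gauss_form !b0 mulr0 oppr0 expR0 mul1r add0r.
    rewrite integral_dirac//= diracE in_setT mul1e b0 mulr0 oppr0 expR0.
    by rewrite expr0 det_mx00 divr1 sqrtr1 !mul1r.
  split => //; apply/integrableP; split.
    by apply/measurable_EFinP; exact: measurable_gauss_form.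
  under eq_integral do rewrite /= /gauss_form ger0_norm ?expR_ge0// b0 mulr0 oppr0 expR0.
  by rewrite integral_dirac//= diracE in_setT mul1e ltry.
have [AT _] := pA; have a0 : 0 < A 0 0 := @pos_def_00 _ d _ pA.
have a_neq0 : A 0 0 != 0 by rewrite gt_eqF.
have [ig' I'] := IH (@schur _ d A) (@rsubmx _ 1 1 d nu) (@pos_def_schur _ d _ pA).
have mc := @measurable_tuple_cons _ mR d.
have mgf := measurable_gauss_form A nu.
have ig : (leb \x lebesgue_tuple R d)%E.-integrable setT
    (fun p => (gauss_form A nu (tuple_cons p))%:E).
  (* By Tonelli it suffices that the iterated integral is finite; the inner one is a multiple of the
     [d]-dimensional Gaussian. *)
  apply/integrable21ltyP.
    by apply/measurable_EFinP; exact: measurableT_comp.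
  under eq_integral => t _.
    under eq_integral => x _ do rewrite /= ger0_norm ?expR_ge0//.
    rewrite (@integral_gauss_form_cons0 d)//.
    over.
  rewrite integralZl//; apply: lte_mul_pinfty => //; apply: integrable_lty => //.
have igA : (lebesgue_tuple R d.+1).-integrable setT (EFin \o gauss_form A nu).
  (* By definition the measure on [d.+1]-tuples is the pushforward of the product under
     [tuple_cons]. *)
  apply: (@integrable_pushforward _ _ _ _ _ _ mc (leb \x lebesgue_tuple R d)%E) => //.
  exact/measurable_EFinP.
split=> // r phi.
have mf := measurable_gauss_form_cos A nu r phi.
have igc : (leb \x lebesgue_tuple R d)%E.-integrable setT
    (fun p => (gauss_form A nu (tuple_cons p) *
      cos (bform A r (rV_of_tuple (tuple_cons p) - nu) + phi))%:E).
  apply: le_integrable ig => //.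
    by apply/measurable_EFinP; exact: (measurableT_comp mf).
  move=> p _; rewrite lee_fin normrM ler_piMr//.
  exact: cos_max.
rewrite (integral_pushforward (mu := (leb \x lebesgue_tuple R d)%E) mc)//; last first.
  exact/measurable_EFinP.
rewrite -integral21_prod_meas1//=.
rewrite /fubini_G.
under eq_integral => t _ do rewrite (@integral_gauss_form_cons d)//.
rewrite integralZl//; last first.
  apply: le_integrable ig' => //.
    by apply/measurable_EFinP; exact: measurable_gauss_form_cos.
  move=> p _; rewrite lee_fin normrM ler_piMr//.
  exact: cos_max.
rewrite I' -EFinM; congr EFin.
have d0 := pos_def_det_gt0 (@pos_def_schur _ d _ pA).
rewrite (@det_schur _ d)// (@bform_schur _ d _ r r)//.
have -> : (2 * pi) ^+ d.+1 / (A 0 0 * \det (schur A)) =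
    (2 * pi / A 0 0) * ((2 * pi) ^+ d / \det (schur A)) :> R.
  by rewrite exprS; field; rewrite a_neq0 gt_eqF.
have p0 : 0 <= 2 * pi / A 0 0 by rewrite divr_ge0// ?(ltW a0)// mulr_ge0// pi_ge0.
rewrite (sqrtrM _ p0).
rewrite [- (2^-1 * (_ + _))](_ : _ = - ((r *m A) 0 0 ^+ 2 / (2 * A 0 0)) +
   - (2^-1 * bform (schur A) (@rsubmx _ 1 1 d r) (@rsubmx _ 1 1 d r))); last by field.
by rewrite expRD; ring.
Qed.

End tuple_gauss.

(** * Characteristic functions and total variation *)

Section tv.
Variables (R : realType) (d : nat).
Local Notation mR := (measurableTypeR R).
Implicit Types (S : 'M[R]_d) (mu u : 'rV[R]_d).

Definition dotp (u v : 'rV[R]_d) : R := (u *m v^T) 0 0.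

Lemma dotpBr u v w : dotp u (v - w) = dotp u v - dotp u w.
Proof. by rewrite /dotp linearB/= mulmxBr !mxE. Qed.

Lemma pos_def_unit S : pos_def_mx S -> S \in unitmx.
Proof. by move=> pS; rewrite unitmxE unitfE gt_eqF// pos_def_det_gt0. Qed.

Lemma pos_def_inv S : pos_def_mx S -> pos_def_mx (invmx S).
Proof.
move=> pS; have uS := pos_def_unit pS; have [ST Sp] := pS.
have IT : (invmx S)^T = invmx S by rewrite trmx_inv ST.
split=> // v v0.
have w0 : v *m invmx S != 0.
  by apply: contra_neq v0 => /(congr1 (mulmx^~ S)); rewrite mulmxKV// mul0mx.
by have := Sp _ w0; rewrite trmx_mul IT mulmxKV// mulmxA.
Qed.

Lemma gaussian_pdfE mu S (t : d.-tuple mR) : gaussian_pdf mu S (rV_of_tuple t) =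
  (Num.sqrt ((2 * pi) ^+ d * \det S))^-1 * gauss_form (invmx S) mu t.
Proof. by []. Qed.

Lemma measurable_gaussian_pdf mu S :
  measurable_fun setT (fun t : d.-tuple mR => gaussian_pdf mu S (rV_of_tuple t)).
Proof.
under eq_fun do rewrite gaussian_pdfE.
by apply: measurable_funM => //; exact: measurable_gauss_form.
Qed.

Lemma measurable_cos_dotp mu u phi :
  measurable_fun setT (fun t : d.-tuple mR => cos (dotp u (rV_of_tuple t - mu) + phi)).
Proof.
apply: (measurableT_comp (@measurable_cos R)); apply: measurable_funD => //.
rewrite (_ : (fun x => _) = (fun t : d.-tuple mR => bform 1%:M u (rV_of_tuple t - mu))).
  by apply: measurable_bform => i //; exact: measurable_rV_of_tuple.
by apply/funext => t; rewrite /bform mulmx1.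
Qed.

Lemma integrable_gaussian_pdf mu S : pos_def_mx S ->
  (lebesgue_tuple R d).-integrable setT
    (fun t => (gaussian_pdf mu S (rV_of_tuple t))%:E).
Proof.
move=> pS; have [ig _] := gauss_tuple mu (pos_def_inv pS).
by under eq_fun do rewrite gaussian_pdfE EFinM; exact: integrableZl.
Qed.

(** Taking [r = u *m S] in [gauss_tuple] turns the form of [invmx S] into [dotp u]; recentring from
    [mu] to [mu0] only shifts the phase. *)
Lemma integral_gaussian_cos mu S mu0 u phi : pos_def_mx S ->
  \int[lebesgue_tuple R d]_t
    (gaussian_pdf mu S (rV_of_tuple t) * cos (dotp u (rV_of_tuple t - mu0) + phi)) =
  expR (- (2^-1 * bform S u u)) * cos (dotp u (mu - mu0) + phi).
Proof.
move=> pS; have uS := pos_def_unit pS; have [ST _] := pS.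
have [ig /(_ (u *m S) (dotp u (mu - mu0) + phi)) E] := gauss_tuple mu (pos_def_inv pS).
have d0 := pos_def_det_gt0 pS.
pose f (t : d.-tuple mR) := gauss_form (invmx S) mu t *
  cos (bform (invmx S) (u *m S) (rV_of_tuple t - mu) + (dotp u (mu - mu0) + phi)).
have igf : (lebesgue_tuple R d).-integrable setT (EFin \o f).
  apply: le_integrable ig => //.
    by apply/measurable_EFinP; exact: measurable_gauss_form_cos.
  by move=> p _; rewrite lee_fin normrM ler_piMr// cos_max.
transitivity (\int[lebesgue_tuple R d]_t
    ((Num.sqrt ((2 * pi) ^+ d * \det S))^-1 * f t)).
  apply: eq_Rintegral => t _; rewrite gaussian_pdfE -mulrA; congr (_ * (_ * cos _)).
  rewrite {1}/bform mulmxK// -/(dotp _ _) !dotpBr.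
  by rewrite addrA subrKA.
rewrite RintegralZl// /Rintegral E/= -/(dotp _ _).
have -> : bform (invmx S) (u *m S) (u *m S) = bform S u u.
  by rewrite /bform mulmxK// trmx_mul ST mulmxA.
rewrite det_inv invrK mulrA mulrA mulVf ?mul1r//.
by rewrite gt_eqF// sqrtr_gt0 mulr_gt0// exprn_gt0// mulr_gt0// pi_gt0.
Qed.

(* The expectation of [cos (<u, X - mu0> + phi)] for [X] with density [mixture];
   [phi = 0] and [phi = - pi / 2] give the two parts of the characteristic function. *)
Definition mix_charfun (mu0 : 'rV[R]_d) (S0 : 'M[R]_d) (G : mix_param R d) u phi : R :=
  let: (lam, mu, Sigma) := G in
  (1 - lam) * (expR (- (2^-1 * bform S0 u u)) * cos phi) +
  lam * (expR (- (2^-1 * bform Sigma u u)) * cos (dotp u (mu - mu0) + phi)).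

Lemma integrable_mixture mu0 S0 (G : mix_param R d) :
  pos_def_mx S0 -> pos_def_mx G.2 ->
  (lebesgue_tuple R d).-integrable setT
    (fun t => (mixture (gaussian_pdf mu0 S0) (@gaussian_pdf R d) G (rV_of_tuple t))%:E).
Proof.
case: G => -[lam mu] S /= p0 pS.
under eq_fun do rewrite EFinD !EFinM.
by apply: integrableD => //; apply: integrableZl => //; exact: integrable_gaussian_pdf.
Qed.

Lemma integrable_mixture_cos mu0 S0 (G : mix_param R d) u phi :
  pos_def_mx S0 -> pos_def_mx G.2 ->
  (lebesgue_tuple R d).-integrable setT
    (fun t => (mixture (gaussian_pdf mu0 S0) (@gaussian_pdf R d) G (rV_of_tuple t) *
       cos (dotp u (rV_of_tuple t - mu0) + phi))%:E).
Proof.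
move=> p0 pS.
apply: le_integrable (integrable_mixture mu0 p0 pS) => //.
  apply/measurable_EFinP; apply: measurable_funM; last exact: measurable_cos_dotp.
  by apply/measurable_EFinP; apply: measurable_int (integrable_mixture mu0 p0 pS).
by move=> p _; rewrite lee_fin normrM ler_piMr// cos_max.
Qed.

Lemma integral_mixture_cos mu0 S0 (G : mix_param R d) u phi :
  pos_def_mx S0 -> pos_def_mx G.2 ->
  \int[lebesgue_tuple R d]_t
    (mixture (gaussian_pdf mu0 S0) (@gaussian_pdf R d) G (rV_of_tuple t) *
       cos (dotp u (rV_of_tuple t - mu0) + phi)) = mix_charfun mu0 S0 G u phi.
Proof.
case: G => -[lam mu] S /= p0 pS.
have iS S' mu' : pos_def_mx S' -> (lebesgue_tuple R d).-integrable setT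
    (fun t => (gaussian_pdf mu' S' (rV_of_tuple t) *
       cos (dotp u (rV_of_tuple t - mu0) + phi))%:E).
  move=> pS'; apply: le_integrable (integrable_gaussian_pdf mu' pS') => //.
    apply/measurable_EFinP; apply: measurable_funM; last exact: measurable_cos_dotp.
    exact: measurable_gaussian_pdf.
  by move=> p _; rewrite lee_fin normrM ler_piMr// cos_max.
under eq_Rintegral => t _.
  rewrite mulrDl -(mulrA (1 - lam)) -(mulrA lam).
  over.
rewrite RintegralD//; last 2 first.
- exact: (integrableZl measurableT (1 - lam) (iS _ mu0 p0)).
- exact: (integrableZl measurableT lam (iS _ mu pS)).
rewrite !RintegralZl//; try exact: iS.
rewrite !integral_gaussian_cos// subrr.
by rewrite /dotp trmx0 mulmx0 mxE add0r.
Qed.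

(** [D] is the L1 distance of the two densities, which bounds every integral of their difference
    against a cosine. *)
Lemma tv_dist_mixture_ge mu0 S0 (G Gs : mix_param R d) :
  pos_def_mx S0 -> pos_def_mx G.2 -> pos_def_mx Gs.2 ->
  exists2 D : R, tv_dist (mixture (gaussian_pdf mu0 S0) (@gaussian_pdf R d) G)
      (mixture (gaussian_pdf mu0 S0) (@gaussian_pdf R d) Gs) = (2^-1 * D)%:E &
    forall u phi, `|mix_charfun mu0 S0 G u phi - mix_charfun mu0 S0 Gs u phi| <= D.
Proof.
move=> p0 pG pGs.
set p := mixture _ _ G; set q := mixture _ _ Gs.
have ip : (lebesgue_tuple R d).-integrable setT (EFin \o (p \o @rV_of_tuple R d)).
  exact: integrable_mixture.
have iq : (lebesgue_tuple R d).-integrable setT (EFin \o (q \o @rV_of_tuple R d)).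
  exact: integrable_mixture.
have ipq : (lebesgue_tuple R d).-integrable setT
    (fun t => (p (rV_of_tuple t) - q (rV_of_tuple t))%:E) by exact: integrableB ip iq.
have inpq : (lebesgue_tuple R d).-integrable setT
    (fun t => `|p (rV_of_tuple t) - q (rV_of_tuple t)|%:E) by exact: integrable_norm.
exists (\int[lebesgue_tuple R d]_t `|p (rV_of_tuple t) - q (rV_of_tuple t)|).
  rewrite /tv_dist EFinM; congr (_ * _)%E.
  by rewrite /Rintegral fineK//; apply: integrable_fin_num.
move=> u phi.
rewrite -!integral_mixture_cos// -RintegralB//; try exact: integrable_mixture_cos.
have ic : (lebesgue_tuple R d).-integrable setT (fun t =>
    (p (rV_of_tuple t) * cos (dotp u (rV_of_tuple t - mu0) + phi) -
     q (rV_of_tuple t) * cos (dotp u (rV_of_tuple t - mu0) + phi))%:E).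
  exact: (integrableB measurableT (integrable_mixture_cos mu0 u phi p0 pG)
    (integrable_mixture_cos mu0 u phi p0 pGs)).
apply: le_trans (le_normr_Rintegral _ ic) _ => //.
apply: le_Rintegral => //; first exact: integrable_norm.
move=> t _; rewrite -mulrBl normrM ler_piMr//.
exact: cos_max.
Qed.

End tv.

(** * Two weighted pairs and their first four trigonometric moments *)

Section algebra.
Variable R : realType.

(** Last elimination of [moment_separation]: [A], [B], [W], [X], [Y], [Z] stand for the absolute
    values of [al], [be], [w], [x], [y], [z] there, and [r] for [|w| + |ws|]. *)
Lemma combine_minor_bounds (A B W X Y Z r N D : R) :
  0 <= A -> 0 <= B -> 0 <= W -> 0 <= X -> 0 <= Y -> 0 <= Z -> 0 <= D ->
  W <= r -> 2 * r <= 1 -> r ^+ 2 <= 4 * N -> N <= 10 * r ^+ 2 ->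
  A * Z <= 2 * D -> Y <= r * X + Z -> B * X <= A * Y + D ->
  A * (A * X * N) <= 21 * (D * A) + 40 * (D * B) ->
  B * Z <= 2 * D + A * X * N ->
  (W * A + B) * (r * X + Y) <= 4000 * D.
Proof.
move=> A0 B0 W0 X0 Y0 Z0 D0 Wr r1 rN Nr hAZ hY h3 hT hBZ.
have r0 : 0 <= r by exact: le_trans Wr.
have hr : r <= 1 by lra.
have AX0 : 0 <= A * X by rewrite mulr_ge0.
have AY : A * Y <= r * (A * X) + 2 * D.
  have := ler_wpM2l A0 hY; rewrite mulrDr mulrCA; lra.
(* If [B <= A], a factor [A] cancels in the bound on [A * (A * X * N)]. If [A <= B], then
   [A * X <= B * X <= r * (A * X) + 3 * D], and [r <= 1/2] absorbs the middle term. *)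
have hK : (A * X) * r ^+ 2 <= 244 * D.
  have [BA|/ltW AB] := leP B A.
    have [->|An0] := eqVneq A 0; first by rewrite !mul0r mulr_ge0.
    have Ap : 0 < A by rewrite lt_def An0.
    have : A * X * N <= 61 * D.
      rewrite -(ler_pM2l Ap); have := ler_wpM2l D0 BA; lra.
    by have := ler_wpM2l AX0 rN; lra.
  have AXB := ler_wpM2r X0 AB.
  have AX2 := ler_wpM2r AX0 r1.
  have r21 : r ^+ 2 <= 1 by rewrite expr_le1.
  by have := ler_wpM2l AX0 r21; lra.
have AXr : A * X * r * W <= A * X * r ^+ 2.
  by rewrite expr2 mulrA ler_wpM2l// mulr_ge0.
have AYr : A * Y * r <= A * X * r ^+ 2 + 2 * D.
  have := ler_wpM2r r0 AY; have := ler_wpM2l D0 hr; rewrite expr2; lra.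
have AYW : A * Y * W <= A * Y * r by rewrite ler_wpM2l// mulr_ge0.
have BXr : B * X * r <= A * X * r ^+ 2 + 3 * D.
  have := ler_wpM2r r0 h3; have := ler_wpM2l D0 hr; rewrite mulrDl; lra.
have BY : B * Y <= B * X * r + B * Z.
  have := ler_wpM2l B0 hY; rewrite mulrDr; lra.
have := ler_wpM2l AX0 Nr.
lra.
Qed.

Lemma normM_le (x y u c : R) : `|x| <= u -> `|y| <= c -> `|x * y| <= u * c.
Proof. by move=> xu yc; rewrite normrM ler_pM. Qed.

Lemma normM_small (x y e : R) : e <= 1 -> `|x| <= e -> `|y| <= e -> `|x * y| <= e.
Proof.
move=> e1 xe ye; have e0 : 0 <= e by exact: le_trans xe.
by apply: le_trans (normM_le xe ye) _; rewrite ler_piMr.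
Qed.

(** The factor estimated here is [e1] of [moment_separation]; the next three lemmas treat [e2], [ks]
    and [ms]. *)
Lemma third_order_factor (a b c e : R) : e <= 1 -> `|a| <= e -> `|b| <= e -> `|c| <= e ->
  `|1 - (a + b) + (a ^+ 2 + a * b + b ^+ 2) / 3 + c ^+ 2 / 3 - 1| <= 4 * e.
Proof.
move=> e1 ha hb hc.
have := normM_small e1 ha ha; have := normM_small e1 ha hb.
have := normM_small e1 hb hb; have := normM_small e1 hc hc.
move: ha hb; rewrite !ler_norml -!expr2; clear; lra.
Qed.

Lemma fourth_order_factor (a b e : R) : e <= 1 -> `|a| <= e -> `|b| <= e ->
  `|1 - 2 / 3 * (a + b) + (a ^+ 2 + a * b + b ^+ 2) / 6 - 1| <= 2 * e.
Proof.
move=> e1 ha hb.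
have := normM_small e1 ha ha; have := normM_small e1 ha hb.
have := normM_small e1 hb hb.
move: ha hb; rewrite !ler_norml -!expr2; clear; lra.
Qed.

Lemma third_order_bound (a w e : R) : e <= 1 -> 10 * e <= 1 -> `|a| <= e -> `|w| <= e ->
  `|- (3 * a) + 3 * a ^+ 2 - a ^+ 3 + w ^+ 2 - a * w ^+ 2| <= 1.
Proof.
move=> e1 e10 ha hw.
have h2 := normM_small e1 ha ha; have := normM_small e1 ha h2.
have w2 := normM_small e1 hw hw; have := normM_small e1 ha w2.
move: h2 w2 ha e10; rewrite !ler_norml -!expr2 -exprS; clear; lra.
Qed.

Lemma fourth_order_bound (a e : R) : e <= 1 -> 22 * e <= 1 -> `|a| <= e ->
  `|- (6 * a) + 4 * a ^+ 2 - a ^+ 3| <= 2^-1.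
Proof.
move=> e1 e10 ha.
have h2 := normM_small e1 ha ha; have := normM_small e1 ha h2.
move: h2 ha e10; rewrite !ler_norml -!expr2 -exprS; clear; lra.
Qed.

(** In terms of [Q = w^2 + v^2] and [T = (w + v)^2 <= 2 Q], the unperturbed [N] is
    [9/2 Q - 3/2 T >= 3/2 Q]. This margin absorbs the deviation of [e1], [e2] and [1 - a] from
    one. *)
Lemma quadratic_form_bounds (w v a e1 e2 : R) : `|a| <= 200^-1 ->
  `|e1 - 1| <= 50^-1 -> `|e2 - 1| <= 100^-1 ->
  let N := 9 * e1 ^+ 2 * (w ^+ 2 + w * v + v ^+ 2) - 6 * e2 * ((w + v) * (1 - a)) ^+ 2 in
  (`|w| + `|v|) ^+ 2 <= 4 * N /\ N <= 10 * (`|w| + `|v|) ^+ 2.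
Proof.
move=> ha h1 h2 N.
have [[h1a h1b] [h2a h2b]] : (49 / 50 <= e1 /\ e1 <= 51 / 50) /\ (99 / 100 <= e2 /\ e2 <= 101 / 100).
  by move: h1 h2; rewrite !ler_norml; clear; lra.
have [ha1 ha2] : 199 / 200 <= 1 - a /\ 1 - a <= 201 / 200.
  by move: ha; rewrite !ler_norml; clear; lra.
have r2 : (`|w| + `|v|) ^+ 2 <= 2 * (w ^+ 2 + v ^+ 2).
  have := sqr_ge0 (`|w| - `|v|); rewrite -(real_normK (num_real w)) -(real_normK (num_real v)).
  by clear; nra.
have r2' : w ^+ 2 + v ^+ 2 <= (`|w| + `|v|) ^+ 2.
  have := mulr_ge0 (normr_ge0 w) (normr_ge0 v).
  rewrite -[w ^+ 2](real_normK (num_real w)) -[v ^+ 2](real_normK (num_real v)).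
  by clear; nra.
have S0 : 0 <= (w + v) ^+ 2 by exact: sqr_ge0.
have S2 : (w + v) ^+ 2 <= 2 * (w ^+ 2 + v ^+ 2).
  by have := sqr_ge0 (w - v); clear; nra.
have Q0 : 0 <= w ^+ 2 + v ^+ 2 by rewrite addr_ge0// sqr_ge0.
have [E1 E2] : 24 / 25 <= e1 ^+ 2 /\ e1 ^+ 2 <= 21 / 20.
  by move: h1a h1b; clear; nra.
have [a1 a2] : 99 / 100 <= (1 - a) ^+ 2 /\ (1 - a) ^+ 2 <= 101 / 100 + 1 / 2000.
  by move: ha1 ha2; clear; nra.
have [F1 F2] : 9 / 10 <= e2 * (1 - a) ^+ 2 /\ e2 * (1 - a) ^+ 2 <= 103 / 100.
  by move: h2a h2b a1 a2; clear; nra.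
have NE : N = 9 / 2 * e1 ^+ 2 * ((w ^+ 2 + v ^+ 2) + (w + v) ^+ 2)
    - 6 * (e2 * (1 - a) ^+ 2) * (w + v) ^+ 2 by rewrite /N; field.
move: NE r2 r2' S0 S2 Q0 E1 E2 F1 F2.
move: N (e1 ^+ 2) (e2 * _) ((w + v) ^+ 2) (w ^+ 2 + v ^+ 2) (_ ^+ 2) => N E F T Q r.
clear; move=> -> r2 r2' S0 S2 Q0 E1 E2 F1 F2.
have := ler_wpM2r Q0 E1; have := ler_wpM2r Q0 E2.
have := ler_wpM2r S0 E1; have := ler_wpM2r S0 E2.
have := ler_wpM2r S0 F1; have := ler_wpM2r S0 F2.
by split; lra.
Qed.

(* With [k = w^2 - 3a + ..] and [m = -6a + ..] (signs and higher order terms below),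
   the third datum is [w * k] and the fourth [w * w^3 + a * m]. Each 2x2 minor of the
   data of the two pairs is [O(D)]; eliminating [y] from the minors leaves
   [w (w - ws)] times the form [N], which is definite because
   [9 (w^2 + w ws + ws^2) - 6 (w + ws)^2 = 3 (w^2 - w ws + ws^2)]. *)
Lemma moment_separation (l ls w ws a b D : R) : 0 <= l ->
  `|w| <= 200^-1 -> `|ws| <= 200^-1 -> `|a| <= 200^-1 -> `|b| <= 200^-1 ->
  `|l * w - ls * ws| <= D -> `|l * a - ls * b| <= D ->
  `|l * (w * (1 - a) * ((1 - a) ^+ 2 + w ^+ 2) - w) -
    ls * (ws * (1 - b) * ((1 - b) ^+ 2 + ws ^+ 2) - ws)| <= D ->
  `|l * (1 - (1 - a) ^+ 4 + w ^+ 4 - 4 * a) -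
    ls * (1 - (1 - b) ^+ 4 + ws ^+ 4 - 4 * b)| <= D ->
  l * (w ^+ 2 + `|a|) * ((`|w| + `|ws|) * `|w - ws| + `|a - b|) <= 4000 * D.
Proof.
move=> l0 Hw Hws Ha Hb.
set v1 := l * w - _; set v2 := l * a - _; set v3 := l * (_ * _ * _ - _) - _.
set v4 := l * (_ + _ - _) - _ => H1 H2 H3 H4.
have D0 : 0 <= D by exact: le_trans H1.
pose al := l * w; pose be := l * a; pose x := w - ws; pose y := a - b.
pose k := - (3 * a) + 3 * a ^+ 2 - a ^+ 3 + w ^+ 2 - a * w ^+ 2.
pose ks := - (3 * b) + 3 * b ^+ 2 - b ^+ 3 + ws ^+ 2 - b * ws ^+ 2.
pose ms := - (6 * b) + 4 * b ^+ 2 - b ^+ 3.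
pose z := k - ks.
pose M := w ^+ 2 + w * ws + ws ^+ 2.
pose e1 := 1 - (a + b) + (a ^+ 2 + a * b + b ^+ 2) / 3 + ws ^+ 2 / 3.
pose e2 := 1 - 2 / 3 * (a + b) + (a ^+ 2 + a * b + b ^+ 2) / 6.
pose g := (w + ws) * (1 - a).
pose N := 9 * e1 ^+ 2 * M - 6 * e2 * g ^+ 2.
have zE : z = g * x - 3 * e1 * y by rewrite /z /k /ks /g /x /e1 /y; field.
(* In each of these three combinations the weight [ls] cancels, and the multipliers of [v1] and [v2]
   are bounded. *)
have P1 : al * z = v3 - v1 * ks by rewrite /al /z /k /ks /v3 /v1; ring.
have P3 : be * x - al * y = b * v1 - ws * v2 by rewrite /al /be /x /y /v1 /v2; ring.
have P2 : al * x * M - 6 * e2 * (be * y) = v4 - v1 * ws ^+ 3 - v2 * ms.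
  by rewrite /al /be /x /y /M /e2 /v1 /v2 /v4 /ms; field.
(* The terms in [al * y] cancel, and those in [be] regroup by [zE] into a multiple of [be * z]. *)
have T : al * x * N + 18 * e1 * e2 * (be * z) =
    9 * e1 ^+ 2 * (al * x * M - 6 * e2 * (be * y)) - 6 * e2 * g * (al * z)
    + 18 * e1 * e2 * g * (be * x - al * y).
  by rewrite /N zE; ring.
have u1 : 200^-1 <= 1 :> R by clear; lra.
have B1 : `|e1 - 1| <= 50^-1.
  by apply: le_trans (third_order_factor u1 Ha Hb Hws) _; clear; lra.
have B2 : `|e2 - 1| <= 100^-1.
  by apply: le_trans (fourth_order_factor u1 Ha Hb) _; clear; lra.
have ks1 : `|ks| <= 1 by apply: third_order_bound Hb Hws => //; clear; lra.
have ms1 : `|ms| <= 2^-1 by apply: fourth_order_bound Hb => //; clear; lra.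
have w31 : `|ws ^+ 3| <= 2^-1.
  rewrite !exprS expr0 mulr1; apply: le_trans (normM_small u1 Hws (normM_small u1 Hws Hws)) _.
  by clear; lra.
have Q1 : `|al * z| <= 2 * D.
  rewrite P1; apply: le_trans (ler_normB _ _) _.
  by move: H3 (normM_le H1 ks1); clear; lra.
have Q3 : `|be * x - al * y| <= D.
  rewrite P3; apply: le_trans (ler_normB _ _) _.
  by move: D0 (normM_le Hb H1) (normM_le Hws H2); clear; lra.
have Q2 : `|al * x * M - 6 * e2 * (be * y)| <= 2 * D.
  rewrite P2; apply: le_trans (ler_normB _ _) _.
  move: (ler_normB v4 (v1 * ws ^+ 3)) H4.
  by move: (normM_le H1 w31) (normM_le H2 ms1); clear; lra.
have [N1 N2] := quadratic_form_bounds w ws Ha B1 B2.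
rewrite -/M -/g -/N in N1 N2.
have [[e1l e1u] [e2l e2u]] :
    (49 / 50 <= e1 /\ e1 <= 51 / 50) /\ (99 / 100 <= e2 /\ e2 <= 101 / 100).
  by move: B1 B2; rewrite !ler_norml; clear; lra.
have e1sq : 0 <= e1 ^+ 2 <= 105 / 100.
  by rewrite sqr_ge0; move: e1l e1u; clear; nra.
have [e12l e12u] : 97 / 100 <= e1 * e2 /\ e1 * e2 <= 104 / 100.
  by move: e1l e1u e2l e2u; clear; nra.
set r := `|w| + `|ws|.
have r_small : r <= 50^-1 by rewrite /r; move: Hw Hws; clear; lra.
have gr : `|g| <= 201 / 200 * r.
  rewrite /g normrM mulrC ler_pM//; last exact: ler_normD.
  by move: Ha; rewrite !ler_norml; clear; lra.
have gs : `|g| <= 40^-1 by move: gr r_small; clear; lra.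
have N0 : 0 <= N by move: N1 (sqr_ge0 r); rewrite -/r; clear; lra.
have T20 : `|al * x * N + 18 * e1 * e2 * (be * z)| <= 21 * D.
  rewrite T; apply: le_trans (ler_normD _ _) _.
  have t1 : `|9 * e1 ^+ 2 * (al * x * M - 6 * e2 * (be * y))| <= 9 * (105 / 100) * (2 * D).
    apply: normM_le Q2; rewrite ger0_norm; last by rewrite mulr_ge0 ?sqr_ge0.
    by rewrite ler_wpM2l//; case/andP: e1sq.
  have t2 : `|6 * e2 * g * (al * z)| <= 7 * 40^-1 * (2 * D).
    apply: normM_le Q1; apply: normM_le gs; rewrite ger0_norm; by move: e2l e2u; clear; lra.
  have t3 : `|18 * e1 * e2 * g * (be * x - al * y)| <= 20 * 40^-1 * D.
    apply: normM_le Q3; apply: normM_le gs.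
    by rewrite -mulrA ger0_norm; move: e12l e12u; clear; lra.
  have := ler_normB (9 * e1 ^+ 2 * (al * x * M - 6 * e2 * (be * y))) (6 * e2 * g * (al * z)).
  by move: t1 t2 t3 D0; clear; lra.
have Aw : `|al| = l * `|w| by rewrite normrM ger0_norm.
have Ba : `|be| = l * `|a| by rewrite normrM ger0_norm.
have -> : l * (w ^+ 2 + `|a|) = `|w| * `|al| + `|be|.
  by rewrite Aw Ba -(real_normK (num_real w)); ring.
have X0 := normr_ge0 x; have Y0 := normr_ge0 y; have Z0 := normr_ge0 z.
have A0 := normr_ge0 al; have B0 := normr_ge0 be.
rewrite -/x -/y -/r.
apply: (@combine_minor_bounds _ _ _ _ _ `|z| _ N D) => //.
- by rewrite lerDl.
- by move: r_small; clear; lra.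
- by rewrite -normrM.
- have : `|3 * e1 * y| <= `|g * x| + `|z|.
    by rewrite (_ : 3 * e1 * y = g * x - z) ?ler_normB// zE; ring.
  rewrite (normrM (3 * e1)) (normrM 3) (normrM g) (ger0_norm (x := 3))// (ger0_norm (x := e1)); last by move: e1l; clear; lra.
  move: (ler_wpM2r X0 gr) (ler_wpM2r Y0 e1l) (mulr_ge0 (addr_ge0 (normr_ge0 w) (normr_ge0 ws)) X0)
    (normr_ge0 y) (normr_ge0 z).
  by rewrite -/r; clear; lra.
- rewrite -!normrM.
  have := ler_normD (be * x - al * y) (al * y); rewrite subrK.
  by move: Q3; clear; lra.
(* The product [be * z] has no bound of its own yet, but after multiplication by [al] it contains
   the bounded minor [al * z]. *)
- have -> : `|al| * (`|al| * `|x| * N) = `|al * (al * x * N + 18 * e1 * e2 * (be * z))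
      - (18 * (e1 * e2)) * (be * (al * z))|.
    rewrite -[in LHS](ger0_norm N0) -!normrM; congr `|_|; ring.
  apply: le_trans (ler_normB _ _) _; rewrite normrM [X in _ + X <= _]normrM.
  have := ler_wpM2l A0 T20.
  have : `|18 * (e1 * e2)| * `|be * (al * z)| <= 20 * (`|be| * (2 * D)).
    apply: ler_pM => //; last by rewrite normrM ler_wpM2l.
    by rewrite ger0_norm; move: e12l e12u; clear; lra.
  by clear; lra.
- have : `|18 * (e1 * e2) * (be * z)| <= 21 * D + `|al| * `|x| * N.
    rewrite (_ : 18 * _ * _ = (al * x * N + 18 * e1 * e2 * (be * z)) - al * x * N); last by ring.
    apply: le_trans (ler_normB _ _) _; apply: lerD => //.
    by rewrite (normrM (al * x)) (normrM al) (ger0_norm N0).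
  have AXN : 0 <= `|al| * `|x| * N by rewrite mulr_ge0// mulr_ge0.
  rewrite normrM ger0_norm; last by move: e12l; clear; lra.
  rewrite (normrM be).
  move: (ler_wpM2r (mulr_ge0 B0 Z0) e12l) D0 AXN (mulr_ge0 B0 Z0).
  by clear; lra.
Qed.

(** Since [(l - ls) u = (l u - ls v) - ls (u - v)], one has [(l - ls) |u| <= D + l |u - v|].
    Multiplying by [|w|^3] for [u = w] and by [|a|] for [u = a] yields terms of the hypothesis, and
    [(w^2 + |a|)^2 <= 2 (w^4 + a^2)]. *)
Lemma weight_gap_bound (l ls w ws a b D : R) : 0 <= ls <= l ->
  `|w| <= 1 -> `|a| <= 1 -> 0 <= D ->
  `|l * w - ls * ws| <= D -> `|l * a - ls * b| <= D ->
  l * (w ^+ 2 + `|a|) * ((`|w| + `|ws|) * `|w - ws| + `|a - b|) <= 4000 * D ->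
  (l - ls) * (w ^+ 2 + `|a|) ^+ 2 <= 9000 * D.
Proof.
move=> /andP[ls0 lsl] Hw Ha D0 H1 H2 H.
have l0 : 0 <= l by exact: le_trans lsl.
have dl : 0 <= l - ls by rewrite subr_ge0.
have gap (u v : R) : `|l * u - ls * v| <= D -> (l - ls) * `|u| <= D + l * `|u - v|.
  move=> uv; rewrite -{1}(ger0_norm dl) -normrM.
  have -> : (l - ls) * u = (l * u - ls * v) - ls * (u - v) by ring.
  apply: le_trans (ler_normB _ _) _; rewrite normrM (ger0_norm ls0).
  by rewrite lerD// ler_wpM2r.
have g1 := gap _ _ H1; have g2 := gap _ _ H2.
have [W0 A0] := (normr_ge0 w, normr_ge0 a).
have [V0 X0 Y0] : [/\ 0 <= `|ws|, 0 <= `|w - ws| & 0 <= `|a - b|] by [].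
rewrite -(real_normK (num_real w)) in H *.
move: (`|w|) (`|a|) (`|ws|) (`|w - ws|) (`|a - b|) Hw Ha H g1 g2 W0 A0 V0 X0 Y0
  => W A V X Y W1 A1 H g1 g2 W0 A0 V0 X0 Y0.
have W3 : 0 <= W ^+ 3 <= 1 by rewrite exprn_ge0// exprn_ile1.
have {W3} [W30 W31] := andP W3.
have k1 := ler_wpM2l W30 g1; have k2 := ler_wpM2l A0 g2.
have m1 := ler_wpM2r D0 W31; have m2 := ler_wpM2r D0 A1.
have lW : 0 <= l * W ^+ 2 by rewrite mulr_ge0 ?sqr_ge0.
have lA : 0 <= l * A by rewrite mulr_ge0.
have p1 := mulr_ge0 lW (mulr_ge0 V0 X0); have p2 := mulr_ge0 lW Y0.
have p3 := mulr_ge0 lA (mulr_ge0 (addr_ge0 W0 V0) X0).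
have p4 := mulr_ge0 dl (sqr_ge0 (W ^+ 2 - A)).
by move: D0 H k1 k2 m1 m2 p1 p2 p3 p4; clear; lra.
Qed.

End algebra.

(** * From trigonometric moments to location and scale *)

Section trigonometry.
Variable R : realType.
Implicit Types x y s th : R.

Lemma sin_mean_value x : exists2 c, `|c| <= `|x| & sin x = cos c * x.
Proof.
have pos y : 0 <= y -> exists2 c, `|c| <= `|y| & sin y = cos c * y.
  move=> y0; have [|c] := @MVT_segment _ (@sin R) (@cos R) 0 y y0.
    by apply: continuous_subspaceT; exact: continuous_sin.
  rewrite in_itv/= sin0 !subr0 => /andP[c0 cy] E.
  by exists c => //; rewrite !ger0_norm.
have [|/ltW x0] := leP 0 x; first exact: pos.
have [|c cx E] := pos (- x); first by rewrite oppr_ge0.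
exists c; first by rewrite -(normrN x).
by apply: oppr_inj; rewrite -sinN E mulrN.
Qed.

Lemma abs_sin_le x : `|sin x| <= `|x|.
Proof.
have [c _ ->] := sin_mean_value x.
by rewrite normrM ler_piMl// cos_max.
Qed.

Lemma cos_ge x : 1 - 2^-1 * x ^+ 2 <= cos x.
Proof.
have -> : cos x = 1 - 2 * sin (x / 2) ^+ 2.
  have E : (x / 2) *+ 2 = x by rewrite mulr2n; field.
  have := cos_mulr2n (x / 2); have := cos2Dsin2 (x / 2); rewrite E mulr2n; lra.
have : sin (x / 2) ^+ 2 <= (x / 2) ^+ 2.
  rewrite -(real_normK (num_real (sin _))) -(real_normK (num_real (x / 2))).
  by rewrite ler_sqr ?nnegrE// abs_sin_le.
by rewrite exprMn; lra.
Qed.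

Lemma abs_le_sin x : `|x| <= 1 -> `|x| <= 2 * `|sin x|.
Proof.
move=> x1; have [c cx ->] := sin_mean_value x; rewrite normrM mulrA.
have c1 : `|c| ^+ 2 <= 1 by rewrite expr_le1// (le_trans cx).
have : 2^-1 <= cos c by have := cos_ge c; rewrite -(real_normK (num_real c)); lra.
move=> c2; rewrite ler_peMl// (le_trans _ (ler_wpM2l _ (ler_norm _)))//.
by lra.
Qed.

Lemma expR_dist s t : `|s| <= 2^-1 -> `|t| <= 2^-1 ->
  `|s - t| <= 2 * `|expR (- s) - expR (- t)|.
Proof.
wlog st : s t / t <= s.
  move=> H; have [|/ltW] := leP t s; first exact: H.
  by move=> st t1 s1; rewrite distrC [X in _ * X]distrC; exact: H.
move=> /(le_trans (ler_norm _)) s1 _.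
have e1 := expR_ge1Dx (s - t); have e2 := expR_ge1Dx (- s).
have E : expR (- t) = expR (- s) * expR (s - t).
  by rewrite -expRD; congr expR; ring.
rewrite ger0_norm ?subr_ge0// distrC ger0_norm; last first.
  by rewrite subr_ge0 ler_expR lerN2.
rewrite E.
have h2 : 2^-1 <= expR (- s) by lra.
have st0 : 0 <= s - t by rewrite subr_ge0.
have h0 : 0 <= expR (- s) by exact: expR_ge0.
have := ler_wpM2l h0 e1; have := ler_wpM2r st0 h2.
lra.
Qed.

(* For [X] normal with mean [th] and variance [s], [cw s th] is the expectation of
   [sin X] and [1 - ca s th] that of [cos X]; here [s] is a difference of variances
   and may be negative. *)
Definition cw s th : R := expR (- (2^-1 * s)) * sin th.
Definition ca s th : R := 1 - expR (- (2^-1 * s)) * cos th.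

(** Eliminates [th]: the squared modulus of the characteristic function sees only the variance. *)
Lemma cwa_sqr s th : (1 - ca s th) ^+ 2 + cw s th ^+ 2 = expR (- s).
Proof.
rewrite /ca /cw subKr !exprMn -mulrDr cos2Dsin2 mulr1 expr2 -expRD.
by congr expR; field.
Qed.

Lemma expR_half_bounds s e : `|s| <= e -> e <= 1 ->
  1 - e <= expR (- (2^-1 * s)) <= 1 + e.
Proof.
rewrite ler_norml => /andP[s1 s2] e1.
have h1 := expR_ge1Dx (- (2^-1 * s)); have h2 := expR_ge1Dx (2^-1 * s).
rewrite expRN in h1 *; set q := expR _ in h1 h2 *.
have q0 : 0 < q by exact: expR_gt0.
have qi : q * q^-1 = 1 by rewrite mulfV// gt_eqF.
have qi0 : 0 <= q^-1 by rewrite invr_ge0 ltW.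
apply/andP; split; first lra.
have := ler_wpM2r qi0 h2; rewrite qi.
have : 2^-1 <= q^-1 by lra.
by nra.
Qed.

Lemma cwa_small s th e : 2 * e <= 1 -> `|s| <= e -> `|th| <= e ->
  `|cw s th| <= 2 * e /\ `|ca s th| <= 3 * e.
Proof.
move=> e1 hs ht; have e0 : 0 <= e by exact: le_trans hs.
have /andP[q1 q2] : 1 - e <= expR (- (2^-1 * s)) <= 1 + e.
  by apply: expR_half_bounds => //; lra.
have q0 : 0 <= expR (- (2^-1 * s)) by exact: expR_ge0.
split.
  rewrite /cw normrM ger0_norm//; apply: ler_pM => //; first by lra.
  exact: le_trans (abs_sin_le _) ht.
have c1 := cos_le1 th; have c2 := cos_ge th.
have t2 : th ^+ 2 <= e.
  rewrite -(real_normK (num_real th)) expr2.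
  apply: le_trans (ler_pM _ _ ht ht) _ => //.
  by rewrite ler_piMr//; lra.
have c0 : 0 <= cos th by lra.
rewrite /ca ler_norml.
have := ler_wpM2l q0 c1; have := ler_wpM2r c0 q1; have := ler_wpM2l e0 c1.
by move=> *; apply/andP; split; lra.
Qed.

(* The pair [(cw, ca)] determines the parameters [(th, s)] with a quadratic loss in [th] only. *)
Lemma cwa_dist s th s' th' e : e <= 100^-1 ->
  `|s| <= e -> `|th| <= e -> `|s'| <= e -> `|th'| <= e ->
  (th - th') ^+ 2 + `|s - s'| <=
  100 * ((`|cw s th| + `|cw s' th'|) * `|cw s th - cw s' th'| + `|ca s th - ca s' th'|).
Proof.
move=> e1 hs ht hs' ht'.
have e2 : 2 * e <= 1 by lra.
have [w1 a1] := cwa_small e2 hs ht; have [w2 a2] := cwa_small e2 hs' ht'.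
have Es := cwa_sqr s th; have Es' := cwa_sqr s' th'.
(* The addition formula isolates [th - th']; the two exponential factors are close to one. *)
have Hsin : expR (- (2^-1 * s)) * expR (- (2^-1 * s')) * sin (th - th') =
    (1 - ca s th) * (cw s th - cw s' th') + cw s th * (ca s th - ca s' th').
  by rewrite sinB /cw /ca; ring.
have /andP[q1 _] : 1 - e <= expR (- (2^-1 * s)) <= 1 + e.
  by apply: expR_half_bounds => //; lra.
have /andP[q1' _] : 1 - e <= expR (- (2^-1 * s')) <= 1 + e.
  by apply: expR_half_bounds => //; lra.
have ds : `|s - s'| <= 2 * `|expR (- s) - expR (- s')|.
  by apply: expR_dist; lra.
have dth1 : `|th - th'| <= 1 by apply: le_trans (ler_normB _ _) _; lra.
have dth := abs_le_sin dth1.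
move: (expR _) (expR (- (2^-1 * s'))) q1 q1' Hsin => q q' q1 q1' Hsin.
rewrite -Es -Es' in ds.
move: (cw s th) (cw s' th') (ca s th) (ca s' th') w1 w2 a1 a2 ds Hsin => w v a b w1 w2 a1 a2 ds Hsin {Es Es'}.
set x := w - v; set y := a - b.
have qq : 2^-1 <= q * q'.
  have : 0 <= (q - 99 / 100) * (q' - 99 / 100) by rewrite mulr_ge0//; lra.
  lra.
have hsin : `|sin (th - th')| <= 3 * `|x| + `|y|.
  have : `|q * q' * sin (th - th')| <= 103 / 100 * `|x| + 2^-1 * `|y|.
    rewrite Hsin; apply: le_trans (ler_normD _ _) _; rewrite !normrM -/x -/y.
    by apply: lerD; rewrite ler_wpM2r//; [move: a1; rewrite !ler_norml|]; lra.
  rewrite normrM ger0_norm; last by lra.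
  have := ler_wpM2r (normr_ge0 (sin (th - th'))) qq.
  by have := normr_ge0 x; lra.
(* These bounds reduce the squares in [dth2]: [|x|^2] to [(|w| + |v|) |x|] and [|y|^2] to [|y|]. *)
have hx : `|x| <= `|w| + `|v| by exact: ler_normB.
have hy : `|y| <= 1 by apply: le_trans (ler_normB _ _) _; lra.
have dth2 : (th - th') ^+ 2 <= 80 * (`|x| * `|x|) + 80 * (`|y| * `|y|).
  rewrite -(real_normK (num_real (th - th'))).
  have h : `|th - th'| <= 6 * `|x| + 2 * `|y| by lra.
  have := ler_pM (normr_ge0 (th - th')) (normr_ge0 (th - th')) h h.
  by have := sqr_ge0 (`|x| - `|y|); have := sqr_ge0 (`|x|); have := sqr_ge0 (`|y|); rewrite !expr2; lra.
have ds2 : `|s - s'| <= 5 * `|y| + 2 * ((`|w| + `|v|) * `|x|).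
  have E : (1 - a) ^+ 2 + w ^+ 2 - ((1 - b) ^+ 2 + v ^+ 2) = (w + v) * x - (2 - a - b) * y.
    by rewrite /x /y; ring.
  rewrite E in ds; have := ler_normB ((w + v) * x) ((2 - a - b) * y).
  rewrite !normrM.
  have := ler_wpM2r (normr_ge0 x) (ler_normD w v).
  have h : `|2 - a - b| <= 5 / 2 by move: a1 a2; rewrite !ler_norml; lra.
  by have := ler_wpM2r (normr_ge0 y) h; lra.
have := ler_wpM2r (normr_ge0 x) hx; have := ler_wpM2r (normr_ge0 y) hy.
have := mulr_ge0 (addr_ge0 (normr_ge0 w) (normr_ge0 v)) (normr_ge0 x).
have := normr_ge0 y.
lra.
Qed.

End trigonometry.

(** * Choice of the direction of projection *)

Section directions.
Variable R : realType.

(** Lagrange interpolation: three nodes determine the coefficients. The worst case is the constant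
    term from nodes 2, 3, 4, with weights 6, -8, 3 of total size 17, below 20. *)
Lemma quadratic_small3 (p0 p1 p2 e : R) (k l m : nat) : (k < l < m)%N -> (m <= 4)%N ->
  let p (i : nat) := p0 + i%:R * (p1 + i%:R * p2) in
  20 * `|p k| < e -> 20 * `|p l| < e -> 20 * `|p m| < e ->
  [/\ `|p0| < e, `|p2| < e & p2 = 0 -> `|p1| < e].
Proof.
case/andP=> kl lm m4 p; rewrite /p.
move: m l k m4 lm kl => [|[|[|[|[|m]]]]] [|[|[|[|[|l]]]]] [|[|[|[|[|k]]]]] // _ _ _;
  rewrite -!ltr_pdivlMl// !ltr_norml; move=> /andP[h1 h2] /andP[h3 h4] /andP[h5 h6];
  split; (try move=> E; try rewrite E in h1 h2 h3 h4 h5 h6); apply/andP; split; lra.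
Qed.

(** Pigeonhole over the five candidates [0..4]: if all failed, three would fail for the same
    polynomial, contradicting [quadratic_small3]. *)
Lemma quadratic_pick (p0 p1 p2 q0 q1 q2 u v : R) :
  u = p0 -> v = q2 \/ q2 = 0 /\ v = q1 ->
  exists2 k : nat, (k <= 4)%N &
    `|u| <= 20 * `|p0 + k%:R * (p1 + k%:R * p2)| /\
    `|v| <= 20 * `|q0 + k%:R * (q1 + k%:R * q2)|.
Proof.
move=> -> hv.
pose P (k : nat) := p0 + k%:R * (p1 + k%:R * p2).
pose Q (k : nat) := q0 + k%:R * (q1 + k%:R * q2).
have noP k l m : (k < l < m)%N -> (m <= 4)%N ->
    20 * `|P k| < `|p0| -> 20 * `|P l| < `|p0| -> 20 * `|P m| < `|p0| -> False.
  by move=> kl m4 h1 h2 h3; have [] := quadratic_small3 kl m4 h1 h2 h3; rewrite ltxx.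
have noQ k l m : (k < l < m)%N -> (m <= 4)%N ->
    20 * `|Q k| < `|v| -> 20 * `|Q l| < `|v| -> 20 * `|Q m| < `|v| -> False.
  move=> kl m4 h1 h2 h3; have [_ c2 c3] := quadratic_small3 kl m4 h1 h2 h3.
  by case: hv c2 c3 => [->|[z ->] _ /(_ z)]; rewrite ltxx.
apply: contrapT => no.
have alt k : (k <= 4)%N -> 20 * `|P k| < `|p0| \/ 20 * `|Q k| < `|v|.
  move=> k4; have [pk|pk] := leP `|p0| (20 * `|P k|); last by left.
  have [qk|qk] := leP `|v| (20 * `|Q k|); last by right.
  by case: no; exists k.
have a0 := alt 0%N isT; have a1 := alt 1%N isT; have a2 := alt 2%N isT.
have a3 := alt 3%N isT; have a4 := alt 4%N isT.
case: a0 a1 a2 a3 a4 => [a0|a0] [a1|a1] [a2|a2] [a3|a3] [a4|a4];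
  first [exact: (noP 0 1 2)%N | exact: (noP 0 1 3)%N | exact: (noP 0 1 4)%N
  | exact: (noP 0 2 3)%N | exact: (noP 0 2 4)%N | exact: (noP 0 3 4)%N
  | exact: (noP 1 2 3)%N | exact: (noP 1 2 4)%N | exact: (noP 1 3 4)%N
  | exact: (noP 2 3 4)%N
  | exact: (noQ 0 1 2)%N | exact: (noQ 0 1 3)%N | exact: (noQ 0 1 4)%N
  | exact: (noQ 0 2 3)%N | exact: (noQ 0 2 4)%N | exact: (noQ 0 3 4)%N
  | exact: (noQ 1 2 3)%N | exact: (noQ 1 2 4)%N | exact: (noQ 1 3 4)%N
  | exact: (noQ 2 3 4)%N].
Qed.

End directions.

(** * Projections of a location-covariance pair along a direction *)

Section probes.
Variables (R : realType) (d : nat).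
Implicit Types (t u : 'rV[R]_d) (S : 'M[R]_d).

(** The one-dimensional counterpart, along [t], of [frob u ^+ 2 + frob S]. *)
Definition probe u S t : R := dotp t u ^+ 2 + `|bform S t t|.

Lemma probe_ge0 u S t : 0 <= probe u S t.
Proof. by rewrite addr_ge0// sqr_ge0. Qed.

Lemma dotpDl t t' u : dotp (t + t') u = dotp t u + dotp t' u.
Proof. by rewrite /dotp mulmxDl mxE. Qed.

Lemma dotpZl (k : R) t u : dotp (k *: t) u = k * dotp t u.
Proof. by rewrite /dotp -scalemxAl mxE. Qed.

Lemma bformD S t t' : S^T = S ->
  bform S (t + t') (t + t') = bform S t t + 2 * bform S t t' + bform S t' t'.
Proof.
move=> ST; have E : bform S t' t = bform S t t'.
  have T : (t' *m S *m t^T)^T = t *m S *m t'^T by rewrite !trmx_mul trmxK ST mulmxA.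
  by rewrite /bform -T [RHS]mxE.
have -> : bform S (t + t') (t + t') =
    bform S t t + bform S t t' + (bform S t' t + bform S t' t').
  by rewrite /bform !mulmxDl linearD/= !mulmxDr [LHS]mxE [X in X + _]mxE [X in _ + X]mxE; ring.
by rewrite E; ring.
Qed.

Lemma bformZ S (k k' : R) t t' : bform S (k *: t) (k' *: t') = k * k' * bform S t t'.
Proof.
rewrite /bform linearZ/= -!scalemxAl -scalemxAr !mxE mulrA; congr (_ * _).
Qed.

Lemma bformB S S' t : bform (S - S') t t = bform S t t - bform S' t t.
Proof. by rewrite /bform mulmxBr mulmxBl !mxE. Qed.

Lemma bform_delta S i j : bform S (delta_mx 0 i) (delta_mx 0 j) = S i j.
Proof. by rewrite /bform -rowE trmx_delta -colE !mxE. Qed.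

Lemma dotp_delta u i : dotp (delta_mx 0 i) u = u 0 i.
Proof. by rewrite /dotp -rowE !mxE. Qed.

Lemma frob_le m n (A : 'M[R]_(m, n)) (K : R) : 0 <= K ->
  (forall i j, `|A i j| <= K) -> frob A ^+ 2 <= (m * n)%:R * K ^+ 2.
Proof.
move=> K0 AK; rewrite /frob sqr_sqrtr; last first.
  by apply: sumr_ge0 => i _; apply: sumr_ge0 => j _; exact: sqr_ge0.
have -> : (m * n)%:R * K ^+ 2 = \sum_(i < m) \sum_(j < n) K ^+ 2.
  by rewrite !sumr_const !card_ord -mulrnA mulnC mulr_natl.
apply: ler_sum => i _; apply: ler_sum => j _.
by rewrite -(real_normK (num_real (A i j))) lerXn2r ?nnegrE.
Qed.

(** Basis vectors recover [u] and the diagonal of [S]; sums of two basis vectors recover the other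
    entries by polarization. All these directions have entries at most 2. *)
Lemma probe_bound u S (K : R) : S^T = S -> 0 <= K ->
  (forall t, (forall i, `|t 0 i| <= 2) -> probe u S t <= K) ->
  frob u ^+ 2 + frob S <= 3 * d%:R * K.
Proof.
move=> ST K0 H.
have en (i j : 'I_d) : `|(delta_mx 0 i : 'rV[R]_d) 0 j| <= 1.
  by rewrite mxE; case: (_ && _); rewrite ?normr1 ?normr0.
have He (i : 'I_d) : probe u S (delta_mx 0 i) <= K.
  by apply: H => j; have := en i j; lra.
have Hee (i j : 'I_d) : probe u S (delta_mx 0 i + delta_mx 0 j) <= K.
  apply: H => k.
  have -> : (delta_mx 0 i + delta_mx 0 j : 'rV[R]_d) 0 k =
      (delta_mx 0 i : 'rV[R]_d) 0 k + (delta_mx 0 j : 'rV[R]_d) 0 k.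
    by rewrite [LHS]mxE.
  by apply: le_trans (ler_normD _ _) _; have := en i k; have := en j k; lra.
have uK (i : 'I_d) : u 0 i ^+ 2 <= K.
  by apply: le_trans (He i); rewrite /probe dotp_delta lerDl.
have bK t : probe u S t <= K -> `|bform S t t| <= K.
  by apply: le_trans; rewrite /probe lerDr sqr_ge0.
have SK i j : `|S i j| <= 2 * K.
  have := bK _ (Hee i j); rewrite bformD// !bform_delta.
  have := bK _ (He i); have := bK _ (He j); rewrite !bform_delta.
  by rewrite !ler_norml; lra.
have f1 : frob u ^+ 2 <= d%:R * K.
  rewrite /frob sqr_sqrtr; last first.
    by apply: sumr_ge0 => i _; apply: sumr_ge0 => j _; exact: sqr_ge0.
  rewrite big_ord1; have -> : d%:R * K = \sum_(j < d) K.
    by rewrite sumr_const card_ord mulr_natl.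
  by apply: ler_sum => j _.
have f2 : frob S <= 2 * d%:R * K.
  rewrite -(@ler_pXn2r _ 2) ?nnegrE//; last 2 first.
  - by rewrite /frob sqrtr_ge0.
  - by rewrite !mulr_ge0.
  apply: le_trans (frob_le _ SK) _; first by rewrite mulr_ge0.
  by rewrite natrM; apply/eqP/eqP => //; rewrite le_eqVlt; apply/orP; left; apply/eqP; ring.
by move: f1 f2; clear; lra.
Qed.

Lemma probe_exists u S : S^T = S ->
  exists2 t : 'rV[R]_d, (forall i, `|t 0 i| <= 2) &
    frob u ^+ 2 + frob S <= (3 * d%:R + 1) * probe u S t.
Proof.
move=> ST; apply: contrapT => no.
have n0 : 0 <= frob u ^+ 2 + frob S by rewrite addr_ge0 ?sqr_ge0// sqrtr_ge0.
(* The extra 1 makes the factor positive even for [d = 0] and the final inequality strict. *)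
have dp : 0 < 3 * d%:R + 1 :> R by rewrite ltr_wpDl// mulr_ge0.
set n := frob u ^+ 2 + frob S in n0 no.
have lt (t : 'rV[R]_d) : (forall i, `|t 0 i| <= 2) -> probe u S t < n / (3 * d%:R + 1).
  move=> t2; rewrite ltNge ler_pdivrMr//; apply/negP => le.
  by case: no; exists t => //; rewrite mulrC.
have K0 : 0 < n / (3 * d%:R + 1).
  by apply: le_lt_trans (probe_ge0 u S 0) (lt _ _) => i; rewrite mxE normr0.
have := probe_bound ST (ltW K0) (fun (t : 'rV[R]_d) (ht : forall i, `|t 0 i| <= 2) => ltW (lt t ht)).
rewrite -/n leNgt => /negP; apply.
rewrite mulrCA; apply: (@lt_le_trans _ _ (n / (3 * d%:R + 1) * (3 * d%:R + 1))).
  by rewrite mulrA mulrDr mulr1 mulrCA mulrA; lra.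
by rewrite divfK// gt_eqF.
Qed.

(** Written in the shape of [quadratic_pick]; the linear form appears as a quadratic with leading
    coefficient [0]. *)
Lemma probe_line u S t t' : S^T = S -> forall k : nat,
  dotp (t + k%:R *: t') u = dotp t u + k%:R * (dotp t' u + k%:R * 0) /\
  bform S (t + k%:R *: t') (t + k%:R *: t') =
  bform S t t + k%:R * (2 * bform S t t' + k%:R * bform S t' t').
Proof.
move=> ST k; split; first by rewrite dotpDl dotpZl; ring.
by rewrite bformD// !bformZ -[t in bform S t (_ *: _)]scale1r bformZ; ring.
Qed.

(* A direction good for the first pair and one good for the second span a line
   containing a direction good for both. *)
Lemma probe_exists2 u S v T : S^T = S -> T^T = T ->
  exists2 t : 'rV[R]_d, (forall i, `|t 0 i| <= 10) &
    frob u ^+ 2 + frob S <= 800 * (3 * d%:R + 1) * probe u S t /\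
    frob v ^+ 2 + frob T <= 800 * (3 * d%:R + 1) * probe v T t.
Proof.
move=> ST TT.
have [t1 t1le h1] := probe_exists u ST; have [t2 t2le h2] := probe_exists v TT.
suff [k k4 [c1 c2]] : exists2 k : nat, (k <= 4)%N &
    probe u S t1 <= 800 * probe u S (t1 + k%:R *: t2) /\
    probe v T t2 <= 800 * probe v T (t1 + k%:R *: t2).
  have dp : 0 <= 3 * d%:R + 1 :> R by rewrite addr_ge0// mulr_ge0.
  exists (t1 + k%:R *: t2).
    move=> i; rewrite !mxE; apply: le_trans (ler_normD _ _) _.
    rewrite normrM ger0_norm//.
    (* The entries of [t1 + k t2] are then at most [2 + 4 * 2 = 10]. *)
    have k4' : k%:R <= 4 :> R by rewrite (ler_nat R k 4).
    have := ler_pM (ler0n R k) (normr_ge0 (t2 0 i)) k4' (t2le i).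
    by have := t1le i; lra.
  split; [apply: le_trans h1 _|apply: le_trans h2 _];
    by rewrite mulrAC mulrC ler_wpM2r.
(* The larger summand of the probe is at least half of it. A loss of 20 in [dotp] becomes 400 after
   squaring, whence [800 = 2 * 400]; [Q] needs only 40. *)
have L (w : 'rV[R]_d) (A : 'M[R]_d) t t' : `|bform A t t| <= dotp t w ^+ 2 ->
    `|dotp t w| <= 20 * `|dotp t' w| -> probe w A t <= 800 * probe w A t'.
  move=> h h'; rewrite /probe.
  have := ler_pM (normr_ge0 _) (normr_ge0 _) h' h'.
  rewrite -(real_normK (num_real (dotp t w))) -(real_normK (num_real (dotp t' w))) in h *.
  by have := normr_ge0 (bform A t' t'); lra.
have Q (w : 'rV[R]_d) (A : 'M[R]_d) t t' : dotp t w ^+ 2 <= `|bform A t t| ->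
    `|bform A t t| <= 20 * `|bform A t' t'| -> probe w A t <= 800 * probe w A t'.
  move=> h h'; rewrite /probe.
  by have := sqr_ge0 (dotp t' w); have := normr_ge0 (bform A t' t'); lra.
(* Along [t1 + k t2], the dominant summand of the first pair at [t1] is the value at [k = 0], and
   that of the second pair at [t2] comes from the top coefficient. *)
have [l1|/ltW l1] := leP `|bform S t1 t1| (dotp t1 u ^+ 2);
  have [l2|/ltW l2] := leP `|bform T t2 t2| (dotp t2 v ^+ 2).
- have [k k4 [c1 c2]] := @quadratic_pick R (dotp t1 u) (dotp t2 u) 0
    (dotp t1 v) (dotp t2 v) 0 _ _ erefl (or_intror (conj erefl erefl)).
  rewrite -(probe_line u t1 t2 ST k).1 in c1; rewrite -(probe_line v t1 t2 TT k).1 in c2.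
  by exists k => //; split; exact: L.
- have [k k4 [c1 c2]] := @quadratic_pick R (dotp t1 u) (dotp t2 u) 0
    (bform T t1 t1) (2 * bform T t1 t2) (bform T t2 t2) _ _ erefl (or_introl erefl).
  rewrite -(probe_line u t1 t2 ST k).1 in c1; rewrite -(probe_line v t1 t2 TT k).2 in c2.
  by exists k => //; split; [exact: L|exact: Q].
- have [k k4 [c1 c2]] := @quadratic_pick R (bform S t1 t1) (2 * bform S t1 t2) (bform S t2 t2)
    (dotp t1 v) (dotp t2 v) 0 _ _ erefl (or_intror (conj erefl erefl)).
  rewrite -(probe_line u t1 t2 ST k).2 in c1; rewrite -(probe_line v t1 t2 TT k).1 in c2.
  by exists k => //; split; [exact: Q|exact: L].
- have [k k4 [c1 c2]] := @quadratic_pick R (bform S t1 t1) (2 * bform S t1 t2) (bform S t2 t2)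
    (bform T t1 t1) (2 * bform T t1 t2) (bform T t2 t2) _ _ erefl (or_introl erefl).
  rewrite -(probe_line u t1 t2 ST k).2 in c1; rewrite -(probe_line v t1 t2 TT k).2 in c2.
  by exists k => //; split; exact: Q.
Qed.

End probes.

(** * Lower bound for the total variation *)

Section assembly.
Variables (R : realType) (d : nat).
Implicit Types (t u : 'rV[R]_d) (S : 'M[R]_d).

Lemma compact_entry_bound m n (A : set 'M[R]_(m, n)) : compact A ->
  exists2 K : R, 0 <= K & forall M, A M -> forall i j, `|M i j| <= K.
Proof.
move=> /compact_bounded [K [Kr HK]].
exists (`|K| + 1) => [|M AM i j]; first by rewrite addr_ge0.
have le1 : `|M| <= `|K| + 1.
  by apply: HK => //; rewrite (le_lt_trans (ler_norm _))// ltrDl.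
apply: le_trans le1; rewrite [leRHS]mx_normrE.
exact: (le_bigmax _ (fun ij => `|M ij.1 ij.2|) (i, j)).
Qed.

Lemma dotp_le t u (T K : R) : (forall i, `|t 0 i| <= T) -> (forall i, `|u 0 i| <= K) ->
  `|dotp t u| <= d%:R * (T * K).
Proof.
move=> tT uK; rewrite /dotp mxE; apply: le_trans (ler_norm_sum _ _ _) _.
have -> : d%:R * (T * K) = \sum_(i < d) T * K by rewrite sumr_const card_ord mulr_natl.
by apply: ler_sum => i _; rewrite mxE normrM ler_pM.
Qed.

Lemma bform_le t S (T K : R) : (forall i, `|t 0 i| <= T) -> (forall i j, `|S i j| <= K) ->
  `|bform S t t| <= d%:R * (T * (d%:R * (T * K))).
Proof.
move=> tT SK.
have -> : bform S t t = dotp t (t *m S^T).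
  by rewrite /bform /dotp trmx_mul trmxK mulmxA.
apply: dotp_le => // i; rewrite mxE; apply: le_trans (ler_norm_sum _ _ _) _.
have -> : d%:R * (T * K) = \sum_(i < d) T * K by rewrite sumr_const card_ord mulr_natl.
by apply: ler_sum => j _; rewrite mxE normrM ler_pM.
Qed.

(** The transform of the known component factors out, leaving only differences from [mu0] and
    [S0]. *)
Lemma mix_charfunE mu0 S0 (G : mix_param R d) t phi :
  mix_charfun mu0 S0 G t phi = expR (- (2^-1 * bform S0 t t)) *
   (cos phi + G.1.1 * (expR (- (2^-1 * bform (G.2 - S0) t t)) *
       cos (dotp t (G.1.2 - mu0) + phi) - cos phi)).
Proof.
case: G => -[l mu] Sg; rewrite /mix_charfun /= bformB.
have -> : expR (- (2^-1 * bform Sg t t)) = expR (- (2^-1 * bform S0 t t)) *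
    expR (- (2^-1 * (bform Sg t t - bform S0 t t))).
  by rewrite -expRD; congr expR; ring.
by ring.
Qed.

Lemma charfun_gap mu0 S0 (G Gs : mix_param R d) t (phi D : R) :
  bform S0 t t <= 1 ->
  `|mix_charfun mu0 S0 G t phi - mix_charfun mu0 S0 Gs t phi| <= D ->
  `|G.1.1 * (expR (- (2^-1 * bform (G.2 - S0) t t)) *
       cos (dotp t (G.1.2 - mu0) + phi) - cos phi) -
    Gs.1.1 * (expR (- (2^-1 * bform (Gs.2 - S0) t t)) *
       cos (dotp t (Gs.1.2 - mu0) + phi) - cos phi)| <= 2 * D.
Proof.
move=> b1; rewrite !mix_charfunE -mulrBr normrM ger0_norm ?expR_ge0//.
have := expR_ge1Dx (- (2^-1 * bform S0 t t)); set E := expR _ => E1.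
set z := G.1.1 * _; set zs := Gs.1.1 * _.
have -> : cos phi + z - (cos phi + zs) = z - zs by ring.
have E2 : 2^-1 <= E by move: E1 b1; clear; lra.
by move: (ler_wpM2r (normr_ge0 (z - zs)) E2); clear; lra.
Qed.

(** Phases [0] and [- pi / 2] at [t] and [2 t] supply the four data of [moment_separation];
    [cwa_dist] translates the result back to projected means and covariances. *)
Lemma probe_separation : exists2 K : R, 0 < K &
  forall mu0 S0 (G Gs : mix_param R d) t (D : R),
  let small (G : mix_param R d) :=
    `|dotp t (G.1.2 - mu0)| <= 600^-1 /\ `|bform (G.2 - S0) t t| <= 600^-1 in
  0 <= G.1.1 -> 0 <= Gs.1.1 -> small G -> small Gs -> `|bform S0 t t| <= 600^-1 ->
  (forall u phi, `|mix_charfun mu0 S0 G u phi - mix_charfun mu0 S0 Gs u phi| <= D) ->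
  G.1.1 * probe (G.1.2 - mu0) (G.2 - S0) t * probe (G.1.2 - Gs.1.2) (G.2 - Gs.2) t <=
    K * D /\
  (Gs.1.1 <= G.1.1 ->
    (G.1.1 - Gs.1.1) * probe (G.1.2 - mu0) (G.2 - S0) t ^+ 2 <= K * D).
Proof.
(* Each passage from [(w, a)] to [(th, s)] costs 100; the data are bounded by [10 * D], and 9000
   comes from [weight_gap_bound], exceeding the 4000 of [moment_separation]. *)
exists (100 * (100 * (9000 * 10))); first by clear; lra.
move=> mu0 S0 G Gs t D small l0 ls0 [th_le s_le] [ths_le ss_le] b0 H.
have D0 : 0 <= D by exact: le_trans (normr_ge0 _) (H 0 0).
have b1 : bform S0 t t <= 1.
  by move: (le_trans (ler_norm _) b0); clear; lra.
have b2 : bform S0 (2 *: t) (2 *: t) <= 1.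
  by rewrite bformZ; move: (le_trans (ler_norm _) b0); clear; lra.
have C1 := charfun_gap b1 (H t 0).
have S1 := charfun_gap b1 (H t (- (pi / 2))).
have C2 := charfun_gap b2 (H (2 *: t) 0).
have S2 := charfun_gap b2 (H (2 *: t) (- (pi / 2))).
move: C1 S1 C2 S2; rewrite !bformZ !dotpZl !addr0 cosN cos0 cos_pihalf !cosBpihalf !subr0.
have -> : probe (G.1.2 - Gs.1.2) (G.2 - Gs.2) t =
    (dotp t (G.1.2 - mu0) - dotp t (Gs.1.2 - mu0)) ^+ 2 +
    `|bform (G.2 - S0) t t - bform (Gs.2 - S0) t t|.
  have e1 : G.1.2 - Gs.1.2 = (G.1.2 - mu0) - (Gs.1.2 - mu0) by rewrite opprB addrA subrK.
  have e2 : G.2 - Gs.2 = (G.2 - S0) - (Gs.2 - S0) by rewrite opprB addrA subrK.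
  by rewrite /probe e1 e2 dotpBr [in bform (_ - _ - _) t t]bformB.
rewrite /probe.
move: (G.1.1) (Gs.1.1) l0 ls0 => l ls l0 ls0.
move: (dotp t (G.1.2 - mu0)) (dotp t (Gs.1.2 - mu0)) th_le ths_le => th ths th_le ths_le.
move: (bform (G.2 - S0) t t) (bform (Gs.2 - S0) t t) s_le ss_le => s ss s_le ss_le.
have EX (r : R) : expR (- (2^-1 * (2 * 2 * r))) = expR (- (2^-1 * r)) ^+ 4.
  by rewrite -expRM_natl; congr expR; rewrite -mulr_natl; field.
(* A factor [cos^2 + sin^2 = 1] makes the double-angle formula homogeneous of degree four, matching
   the fourth power of the exponential. *)
have Ecos (r x : R) : expR (- (2^-1 * (2 * 2 * r))) * cos (2 * x) =
    (1 - ca r x) ^+ 4 - cw r x ^+ 4.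
  rewrite EX /ca /cw subKr !exprMn mulr_natl cos_mulr2n.
  have := cos2Dsin2 x; set c := cos x; set s' := sin x => h.
  have E : s' ^+ 2 = 1 - c ^+ 2 by rewrite -h; ring.
  have -> : s' ^+ 4 = (s' ^+ 2) ^+ 2 by rewrite -exprM.
  by rewrite E mulr2n; ring.
have Eca (r x : R) : expR (- (2^-1 * r)) * cos x - 1 = - ca r x by rewrite /ca; ring.
have Esin (r x : R) : expR (- (2^-1 * (2 * 2 * r))) * sin (2 * x) =
    2 * (cw r x * (1 - ca r x) * ((1 - ca r x) ^+ 2 + cw r x ^+ 2)).
  rewrite EX /ca /cw subKr mulr_natl sin_mulr2n.
  have := cos2Dsin2 x; set c := cos x; set s' := sin x => E.
  by rewrite !exprMn -mulrDr E mulr2n; ring.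
move=> C1 S1 C2 S2.
have {}C1 : `|l * - ca s th - ls * - ca ss ths| <= 2 * D.
  by rewrite -(Eca s th) -(Eca ss ths).
have {}C2 : `|l * ((1 - ca s th) ^+ 4 - cw s th ^+ 4 - 1) -
    ls * ((1 - ca ss ths) ^+ 4 - cw ss ths ^+ 4 - 1)| <= 2 * D.
  by rewrite -(Ecos s th) -(Ecos ss ths).
have {}S1 : `|l * cw s th - ls * cw ss ths| <= 2 * D by exact: S1.
have {}S2 : `|l * (2 * (cw s th * (1 - ca s th) * ((1 - ca s th) ^+ 2 + cw s th ^+ 2))) -
    ls * (2 * (cw ss ths * (1 - ca ss ths) * ((1 - ca ss ths) ^+ 2 + cw ss ths ^+ 2)))| <= 2 * D.
  by rewrite -(Esin s th) -(Esin ss ths).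
have e600 : 2 * 600^-1 <= 1 :> R by clear; lra.
have [w_s a_s] := cwa_small e600 s_le th_le; have [v_s b_s] := cwa_small e600 ss_le ths_le.
have z_le : `|0 : R| <= 600^-1 by rewrite normr0; clear; lra.
have e100 : 600^-1 <= 100^-1 :> R by clear; lra.
have dist := cwa_dist e100 s_le th_le ss_le ths_le.
(* Comparison with the pair [(0, 0)] of the known component bounds [th ^+ 2 + |s|] by a multiple of
   [w ^+ 2 + |a|]. *)
have dist0 := cwa_dist e100 s_le th_le z_le z_le.
have cw0 : cw 0 0 = 0 :> R by rewrite /cw sin0 mulr0.
have ca0 : ca 0 0 = 0 :> R by rewrite /ca cos0 mulr0 oppr0 expR0 mulr1 subrr.
rewrite cw0 ca0 !subr0 in dist0.
rewrite normr0 addr0 -expr2 (real_normK (num_real (cw s th))) in dist0.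
move: (cw s th) (cw ss ths) (ca s th) (ca ss ths) C1 S1 C2 S2 w_s a_s v_s b_s dist dist0
  => w v a b C1 S1 C2 S2 w_s a_s v_s b_s dist dist0.
have V1 : `|l * w - ls * v| <= 10 * D by move: S1 D0; clear; lra.
have V2 : `|l * a - ls * b| <= 10 * D.
  by rewrite -normrN opprB; move: C1 D0; rewrite !mulrN opprK addrC; clear; lra.
have V3 : `|l * (w * (1 - a) * ((1 - a) ^+ 2 + w ^+ 2) - w) -
    ls * (v * (1 - b) * ((1 - b) ^+ 2 + v ^+ 2) - v)| <= 10 * D.
  by move: S1 S2 D0; rewrite !ler_norml; clear; lra.
(* Up to sign this is the cosine datum at [2 t] minus four times the one at [t]: hence
   [10 = 2 + 4 * 2]. *)
have V4 : `|l * (1 - (1 - a) ^+ 4 + w ^+ 4 - 4 * a) -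
    ls * (1 - (1 - b) ^+ 4 + v ^+ 4 - 4 * b)| <= 10 * D.
  by move: C1 C2 D0; rewrite !ler_norml; clear; lra.
have [w200 a200 v200 b200] :
    [/\ `|w| <= 200^-1, `|a| <= 200^-1, `|v| <= 200^-1 & `|b| <= 200^-1].
  by split; [move: w_s|move: a_s|move: v_s|move: b_s]; clear; lra.
have sep := moment_separation l0 w200 v200 a200 b200 V1 V2 V3 V4.
have p0 : 0 <= th ^+ 2 + `|s| by rewrite addr_ge0// sqr_ge0.
have wa0 : 0 <= w ^+ 2 + `|a| by rewrite addr_ge0// sqr_ge0.
split.
  apply: le_trans (ler_pM _ _ (ler_wpM2l l0 dist0) dist) _; rewrite ?mulr_ge0//.
    by rewrite addr_ge0// sqr_ge0.
  rewrite (_ : l * (100 * _) * (100 * _) = 100 * (100 *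
    (l * (w ^+ 2 + `|a|) * ((`|w| + `|v|) * `|w - v| + `|a - b|)))); last by ring.
  by move: sep D0; set p := l * _ * _; clear; lra.
move=> lsl; have dl : 0 <= l - ls by rewrite subr_ge0.
have gap : (l - ls) * (w ^+ 2 + `|a|) ^+ 2 <= 9000 * (10 * D).
  apply: weight_gap_bound V1 V2 sep; rewrite ?ls0//.
  - by move: w200; clear; lra.
  - by move: a200; clear; lra.
  - by rewrite mulr_ge0.
have sq : (th ^+ 2 + `|s|) ^+ 2 <= (100 * (w ^+ 2 + `|a|)) ^+ 2.
  by rewrite lerXn2r ?nnegrE// mulr_ge0.
apply: le_trans (ler_wpM2l dl sq) _.
rewrite (_ : (l - ls) * _ = 100 * (100 * ((l - ls) * (w ^+ 2 + `|a|) ^+ 2))); last by ring.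
by move: gap D0; set p := (l - ls) * _; clear; lra.
Qed.
End assembly.

(** * Uniform constants over the compact parameter sets *)

Section main.
Variables (R : realType) (d : nat).

Lemma probeZ (u t : 'rV[R]_d) (S : 'M[R]_d) (k : R) :
  probe u S (k *: t) = k ^+ 2 * probe u S t.
Proof.
by rewrite /probe dotpZl bformZ -expr2 normrM [`|k ^+ 2|]ger0_norm ?sqr_ge0//; ring.
Qed.

(** Compactness bounds all entries, hence both forms by a constant [B >= 1]. With [tau = e / B <= 1]
    one has [tau^2 <= tau], so one scale serves the linear and the quadratic form. *)
Lemma small_scale (Theta : set 'rV[R]_d) (Omega : set 'M[R]_d) mu0 S0 (e : R) :
  0 < e -> e <= 1 ->
  compact Theta -> compact Omega -> Theta mu0 -> Omega S0 ->
  exists2 tau : R, 0 < tau &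
  forall t : 'rV[R]_d, (forall i, `|t 0 i| <= 10) ->
    [/\ forall mu, Theta mu -> `|dotp (tau *: t) (mu - mu0)| <= e,
        forall S, Omega S -> `|bform (S - S0) (tau *: t) (tau *: t)| <= e &
        `|bform S0 (tau *: t) (tau *: t)| <= e].
Proof.
move=> e0 e1 Theta_compact Omega_compact Theta_mu0 Omega_S0.
have [K K0 HK] := compact_entry_bound Theta_compact.
have [L L0 HL] := compact_entry_bound Omega_compact.
pose B := d%:R * (10 * (2 * K)) + d%:R * (10 * (d%:R * (10 * (2 * L)))) + 1.
have K1 : 0 <= d%:R * (10 * (2 * K)) by rewrite !mulr_ge0.
have L1 : 0 <= d%:R * (10 * (d%:R * (10 * (2 * L)))) by rewrite !mulr_ge0.
have B1 : 1 <= B by rewrite /B lerDr addr_ge0.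
have B0 : 0 < B by exact: lt_le_trans B1.
have tau0 : 0 < e / B by rewrite divr_gt0.
have tauB : e / B * B = e by rewrite divfK// gt_eqF.
have tau1 : e / B <= 1 by rewrite ler_pdivrMr// mul1r (le_trans e1).
exists (e / B) => // t t10.
have lin (x : R) : `|x| <= B -> `|(e / B) * x| <= e.
  move=> xB; rewrite normrM ger0_norm ?(ltW tau0)// -[leRHS]tauB.
  by rewrite (ler_wpM2l (ltW tau0)).
have qua (x : R) : `|x| <= B -> `|(e / B) * (e / B) * x| <= e.
  move=> /lin h; rewrite -mulrA normrM ger0_norm ?(ltW tau0)//.
  by apply: le_trans h; rewrite ler_piMl.
have dist2 (x y : R) M : `|x| <= M -> `|y| <= M -> `|x - y| <= 2 * M.
  by move=> xM yM; apply: le_trans (ler_normB _ _) _; lra.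
split.
- move=> mu hmu; rewrite dotpZl; apply: lin.
  apply: le_trans (dotp_le (K := 2 * K) t10 _) _.
    by move=> i; rewrite !mxE; apply: dist2; exact: HK.
  by rewrite /B; lra.
- move=> S hS; rewrite bformZ; apply: qua.
  apply: le_trans (bform_le (K := 2 * L) t10 _) _.
    by move=> i j; rewrite !mxE; apply: dist2; exact: HL.
  by rewrite /B; lra.
- rewrite bformZ; apply: qua.
  apply: le_trans (bform_le (K := 2 * L) t10 _) _.
    move=> i j; apply: le_trans (HL _ Omega_S0 i j) _.
    by move: L0; clear; lra.
  by rewrite /B; lra.
Qed.

(** The direction [t] depends on the two parameters, but its entries are at most 10, so the scale
    [tau] and the constants are uniform. Probes are homogeneous of degree two, which costs
    [tau ^- 2] for each. *)
Lemma charfun_separation (Theta : set 'rV[R]_d) (Omega : set 'M[R]_d) mu0 S0 :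
  compact Theta -> compact Omega -> (forall S, Omega S -> pos_def_mx S) ->
  Theta mu0 -> Omega S0 ->
  exists2 C : R, 0 < C &
  forall (G Gs : mix_param R d) (D : R),
    mix_param_space Theta Omega G -> mix_param_space Theta Omega Gs ->
    (forall u phi, `|mix_charfun mu0 S0 G u phi - mix_charfun mu0 S0 Gs u phi| <= D) ->
    let size (G : mix_param R d) := frob (G.1.2 - mu0) ^+ 2 + frob (G.2 - S0) in
    G.1.1 * size G * (frob (G.1.2 - Gs.1.2) ^+ 2 + frob (G.2 - Gs.2)) <= C * D /\
    (Gs.1.1 <= G.1.1 -> (G.1.1 - Gs.1.1) * size G ^+ 2 <= C * D).
Proof.
move=> Theta_compact Omega_compact Omega_pos_def Theta_mu0 Omega_S0.
have eps0 : 0 < 600^-1 :> R by clear; lra.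
have eps1 : 600^-1 <= 1 :> R by clear; lra.
have [tau tau0 Htau] := small_scale eps0 eps1 Theta_compact Omega_compact Theta_mu0 Omega_S0.
pose c : R := 800 * (3 * d%:R + 1).
have c0 : 0 < c by rewrite /c; move: (ler0n R d); clear; lra.
pose e := c * tau ^- 2.
have e0 : 0 < e by rewrite mulr_gt0// invr_gt0 exprn_gt0.
have [K K0 HK] := probe_separation R d.
exists (e ^+ 2 * K); first by rewrite mulr_gt0 ?exprn_gt0.
move=> G Gs D [[lG TG] OG] [[lGs TGs] OGs] H size.
have D0 : 0 <= D by exact: le_trans (normr_ge0 _) (H 0 0).
have [l0 ls0] : 0 <= G.1.1 /\ 0 <= Gs.1.1.
  by move: lG lGs; rewrite /= !in_itv /= => /andP[-> _] /andP[-> _].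
have sym S S' : Omega S -> Omega S' -> (S - S')^T = S - S'.
  move=> /Omega_pos_def[ST _] /Omega_pos_def[ST' _].
  by rewrite linearB /= ST ST'.
have [t t10 [h1 h2]] := probe_exists2 (G.1.2 - mu0) (G.1.2 - Gs.1.2)
  (sym _ _ OG Omega_S0) (sym _ _ OG OGs).
have [b1 b2 b3] := Htau t t10.
have [] := HK mu0 S0 G Gs (tau *: t) D l0 ls0
  (conj (b1 _ TG) (b2 _ OG)) (conj (b1 _ TGs) (b2 _ OGs)) b3 H.
rewrite !probeZ.
rewrite -/c in h1 h2.
have scale p : c * p = e * (tau ^+ 2 * p).
  by rewrite /e -mulrA [tau ^- 2 * _]mulrA mulVf ?mul1r// gt_eqF// exprn_gt0.
rewrite scale -/(size G) in h1; rewrite scale in h2.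
have n0 : 0 <= size G by rewrite addr_ge0 ?sqr_ge0// sqrtr_ge0.
have d0 : 0 <= frob (G.1.2 - Gs.1.2) ^+ 2 + frob (G.2 - Gs.2).
  by rewrite addr_ge0 ?sqr_ge0// sqrtr_ge0.
move: (size G) (frob _ ^+ 2 + _) (tau ^+ 2 * probe _ _ _) (tau ^+ 2 * probe _ _ _)
  n0 d0 h1 h2 => n del p' p n0 d0 h1 h2 k1 k2.
have e20 : 0 <= e ^+ 2 by exact: sqr_ge0.
split.
  rewrite -[X in _ <= X]mulrA; apply: le_trans (ler_pM _ _ (ler_wpM2l l0 h1) h2) _; rewrite ?mulr_ge0//.

  rewrite (_ : G.1.1 * (e * p) * (e * p') = e ^+ 2 * (G.1.1 * p * p')); last by ring.
  by rewrite ler_wpM2l.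
move=> lsl; have dl : 0 <= G.1.1 - Gs.1.1 by rewrite subr_ge0.
have sq : n ^+ 2 <= (e * p) ^+ 2 by rewrite lerXn2r ?nnegrE// (le_trans n0).
rewrite -[X in _ <= X]mulrA; apply: le_trans (ler_wpM2l dl sq) _.
rewrite (_ : _ * (e * p) ^+ 2 = e ^+ 2 * ((G.1.1 - Gs.1.1) * p ^+ 2)); last by ring.
by rewrite ler_wpM2l//; exact: k2.
Qed.

End main.

Theorem theorem3p6 (R : realType) (d : nat)
    (Theta : set 'rV[R]_d) (Omega : set 'M[R]_d)
    (mu0 : 'rV[R]_d) (Sigma0 : 'M[R]_d)
    (Theta_compact : compact Theta) (Omega_compact : compact Omega)
    (Omega_pos_def : forall S, Omega S -> pos_def_mx S)
    (Theta_mu0 : Theta mu0) (Omega_Sigma0 : Omega Sigma0) :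
  exists2 C : R, 0 < C &
    forall G Gs : mix_param R d,
      mix_param_space Theta Omega G -> mix_param_space Theta Omega Gs ->
      let h0 := gaussian_pdf mu0 Sigma0 in
      ((C * calQ mu0 Sigma0 G Gs)%:E <=
        tv_dist (mixture h0 (@gaussian_pdf R d) G)
                        (mixture h0 (@gaussian_pdf R d) Gs))%E.
Proof.
have [C C0 HC] := charfun_separation Theta_compact Omega_compact Omega_pos_def
  Theta_mu0 Omega_Sigma0.
(* Three terms of [calQ] are each at most [C * D], and [D] is twice the total variation. *)
exists (6 * C)^-1; first by rewrite invr_gt0 mulr_gt0.
move=> G Gs hG hGs; cbv zeta.
have [D -> H] := tv_dist_mixture_ge mu0 (Omega_pos_def _ Omega_Sigma0)
  (Omega_pos_def _ hG.2) (Omega_pos_def _ hGs.2).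
have Hs u phi : `|mix_charfun mu0 Sigma0 Gs u phi - mix_charfun mu0 Sigma0 G u phi| <= D.
  by rewrite distrC.
have [A1 B1] := HC _ _ _ hG hGs H; have [A2 B2] := HC _ _ _ hGs hG Hs.
rewrite lee_fin ler_pdivrMl ?mulr_gt0//.
rewrite (_ : 6 * C * (2^-1 * D) = C * D + C * D + C * D); last by field.
case: G Gs {hG hGs H Hs} A1 B1 A2 B2 => [[l mu] S] [[ls mus] Ss] /=.
have frobN m n (A B : 'M[R]_(m, n)) : frob (A - B) = frob (B - A).
  rewrite /frob; congr Num.sqrt; apply: eq_bigr => i _; apply: eq_bigr => j _.
  by rewrite -opprB mxE sqrrN.
rewrite (frobN _ _ mus mu) (frobN _ _ Ss S).
have f0 m n (A : 'M[R]_(m, n)) : 0 <= frob A by exact: sqrtr_ge0.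
have := f0 _ _ (S - Sigma0); have := f0 _ _ (Ss - Sigma0).
have := sqr_ge0 (frob (mu - mu0)); have := sqr_ge0 (frob (mus - mu0)).
rewrite (_ : frob (mu - mu0) ^+ 4 = (frob (mu - mu0) ^+ 2) ^+ 2); last by rewrite -exprM.
rewrite (_ : frob (mus - mu0) ^+ 4 = (frob (mus - mu0) ^+ 2) ^+ 2); last by rewrite -exprM.
move: (frob (mu - mu0) ^+ 2) (frob (mus - mu0) ^+ 2) (frob (S - Sigma0)) (frob (Ss - Sigma0))
  (_ + frob (S - Ss)) => x xs y ys del xs0 x0 ys0 y0 A1 B1 A2 B2.
(* For [ls <= l] the terms before the product in [calQ] collapse to [(l - ls) (x^2 + y^2)], at most
   [(l - ls) (x + y)^2]. The other case is symmetric. *)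
have [lsl|/ltW lsl] := leP ls l.
  have dl : 0 <= l - ls by rewrite subr_ge0.
  by move: A1 A2 (B1 lsl) (mulr_ge0 dl (mulr_ge0 x0 y0)); clear; lra.
have dl : 0 <= ls - l by rewrite subr_ge0.
by move: A1 A2 (B2 lsl) (mulr_ge0 dl (mulr_ge0 xs0 ys0)); clear; lra.
Qed.
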